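(* Let $G$ be a subgroup of $\mathbf V(r,\mathbb R^*_+,\mathbb R)$ such that $G\cap \mathbf F(r,\mathbb R^*_+,\mathbb R)=\mathbf F(r,\Lambda,A)$. Then the elementary theory of the group $G$ (in the language of groups) is hereditarily undecidable.
   Context: Maps act on the right. Fix a real $r>0$, a subgroup $\Lambda\neq\{1\}$ of the multiplicative group $\mathbb R^*_+$, and an additive subgroup $A\subseteq\mathbb R$ with $r\in A$ and $\lambda A\subseteq A$ for all $\lambda\in\Lambda$ (the same definitions are used with $\Lambda=\mathbb R^*_+$, $A=\mathbb R$). $\mathbf V(r,\Lambda,A)$ is the group of bijections $x\colon[0,r)\to[0,r)$ that are piecewise affine with finitely many breakpoints and discontinuities, right-continuous everywhere, with all slopes in $\Lambda$, and with all breakpoints and discontinuity points and their images in $A$. $\mathbf F(r,\Lambda,A)$ is the subgroup of elements continuous for the usual topology. A theory of a finite signature $\Sigma$ is a consistent set of $\Sigma$-sentences closed under logical consequence in $\Sigma$; the elementary theory $\mathrm{Th}(M)$ is the set of sentences true in $M$. A $\Sigma$-theory $T$ is hereditarily undecidable if every $\Sigma$-theory contained in $T$ is undecidable (not recursive). *)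

(* Defs.v *)
From Stdlib Require Import Reals List.
Import ListNotations.
Open Scope R_scope.

(* Elements are represented as functions R -> R which map [0,r) onto   *)
(* itself bijectively and are the identity outside [0,r) (so that      *)
(* extensional equality of functions = equality as maps of [0,r)).     *)

Definition is_pos_mult_subgroup (Lam : R -> Prop) : Prop :=
  (forall l, Lam l -> 0 < l) /\ Lam 1 /\
  (forall l m, Lam l -> Lam m -> Lam (l * m)) /\
  (forall l, Lam l -> Lam (/ l)).

Definition is_add_subgroup (A : R -> Prop) : Prop :=
  A 0 /\ (forall a b, A a -> A b -> A (a + b)) /\ (forall a, A a -> A (- a)).

Definition bij_interval (r : R) (f : R -> R) : Prop :=
  (forall x, ~ (0 <= x < r) -> f x = x) /\
  (forall x, 0 <= x < r -> 0 <= f x < r) /\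
  (forall y, 0 <= y < r -> exists x, 0 <= x < r /\ f x = y) /\
  (forall x y, 0 <= x < r -> 0 <= y < r -> f x = f y -> x = y).

Definition pw_affine (r : R) (Lam A : R -> Prop) (f : R -> R) : Prop :=
  exists (n : nat) (a lam b : nat -> R),
    a 0%nat = 0 /\ a n = r /\
    (forall i, (i < n)%nat -> a i < a (S i)) /\
    (forall i, (i <= n)%nat -> A (a i)) /\
    (forall i, (i < n)%nat -> A (f (a i))) /\
    (forall i, (i < n)%nat -> Lam (lam i)) /\
    (forall i x, (i < n)%nat -> a i <= x < a (S i) -> f x = lam i * x + b i).

Definition inV (r : R) (Lam A : R -> Prop) (f : R -> R) : Prop :=
  bij_interval r f /\ pw_affine r Lam A f.

Definition cont_interval (r : R) (f : R -> R) : Prop :=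
  forall x, 0 <= x < r -> forall eps, 0 < eps ->
    exists delta, 0 < delta /\
      forall y, 0 <= y < r -> Rabs (y - x) < delta -> Rabs (f y - f x) < eps.

Definition inF (r : R) (Lam A : R -> Prop) (f : R -> R) : Prop :=
  inV r Lam A f /\ cont_interval r f.

Definition posR : R -> Prop := fun x => 0 < x.
Definition allR : R -> Prop := fun _ => True.

(* G is a subgroup of V(r, R^*_+, R).  Maps act on the right, so the
   product xy is "first x, then y", i.e. the function t |-> y (x t). *)
Definition is_subgroup_V (r : R) (G : (R -> R) -> Prop) : Prop :=
  (forall f, G f -> inV r posR allR f) /\
  G (fun x => x) /\
  (forall f g, G f -> G g -> G (fun x => g (f x))) /\
  (forall f g, G f -> (forall x, g (f x) = x) -> (forall x, f (g x) = x) -> G g).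

(* Variables are de Bruijn indices; connectives: falsum, =, ->, forall *)
(* (the others are definable).                                         *)

Inductive term : Type :=
| tvar : nat -> term
| tone : term
| tmul : term -> term -> term
| tinv : term -> term.

Inductive form : Type :=
| ffal : form
| feq : term -> term -> form
| fimp : form -> form -> form
| fall : form -> form.

Record structure : Type := Structure {
  carrier : Type;
  s_mul : carrier -> carrier -> carrier;
  s_inv : carrier -> carrier;
  s_one : carrier }.

Fixpoint eval_term (M : structure) (e : nat -> carrier M) (t : term) : carrier M :=
  match t with
  | tvar n => e n
  | tone => s_one M
  | tmul s u => s_mul M (eval_term M e s) (eval_term M e u)
  | tinv s => s_inv M (eval_term M e s)
  end.

Definition scons {X : Type} (x : X) (e : nat -> X) : nat -> X :=
  fun n => match n with O => x | S k => e k end.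

Fixpoint sat (M : structure) (e : nat -> carrier M) (phi : form) : Prop :=
  match phi with
  | ffal => False
  | feq s u => eval_term M e s = eval_term M e u
  | fimp p q => sat M e p -> sat M e q
  | fall p => forall x : carrier M, sat M (scons x e) p
  end.

Fixpoint term_below (n : nat) (t : term) : Prop :=
  match t with
  | tvar k => (k < n)%nat
  | tone => True
  | tmul s u => term_below n s /\ term_below n u
  | tinv s => term_below n s
  end.

Fixpoint form_below (n : nat) (phi : form) : Prop :=
  match phi with
  | ffal => True
  | feq s u => term_below n s /\ term_below n u
  | fimp p q => form_below n p /\ form_below n q
  | fall p => form_below (S n) p
  end.

Definition sentence (phi : form) : Prop := form_below 0 phi.

(* M satisfies a sentence (the environment is irrelevant for sentences) *)
Definition models (M : structure) (phi : form) : Prop :=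
  sat M (fun _ => s_one M) phi.

Definition Th (M : structure) : form -> Prop :=
  fun phi => sentence phi /\ models M phi.

(* a theory: a consistent set of sentences closed under logical
   consequence (consequence and consistency taken semantically, which
   is equivalent by the completeness theorem) *)
Definition is_theory (T : form -> Prop) : Prop :=
  (forall phi, T phi -> sentence phi) /\
  (exists M : structure, forall phi, T phi -> models M phi) /\
  (forall phi, sentence phi ->
     (forall M : structure, (forall psi, T psi -> models M psi) -> models M phi) ->
     T phi).

Inductive prf : Type :=
| rZero : prf
| rSucc : prf
| rProj : nat -> prf
| rComp : prf -> list prf -> prf
| rPrec : prf -> prf -> prf
| rMu : prf -> prf.

Inductive reval : prf -> list nat -> nat -> Prop :=
| ev_zero v : reval rZero v 0
| ev_succ x v : reval rSucc (x :: v) (S x)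
| ev_proj i v : (i < length v)%nat -> reval (rProj i) v (nth i v 0%nat)
| ev_comp f gs v ws y : revals gs v ws -> reval f ws y -> reval (rComp f gs) v y
| ev_prec0 f g v y : reval f v y -> reval (rPrec f g) (0%nat :: v) y
| ev_precS f g n v z y :
    reval (rPrec f g) (n :: v) z -> reval g (n :: z :: v) y ->
    reval (rPrec f g) (S n :: v) y
| ev_mu f v n : reval f (n :: v) 0%nat ->
    (forall m, (m < n)%nat -> exists k, reval f (m :: v) (S k)) ->
    reval (rMu f) v n
with revals : list prf -> list nat -> list nat -> Prop :=
| evs_nil v : revals nil v nil
| evs_cons g gs v w ws : reval g v w -> revals gs v ws -> revals (g :: gs) v (w :: ws).

Definition cpair (x y : nat) : nat := Nat.div ((x + y) * (x + y + 1)) 2 + y.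

Fixpoint code_term (t : term) : nat :=
  match t with
  | tvar n => cpair 0 n
  | tone => cpair 1 0
  | tmul s u => cpair 2 (cpair (code_term s) (code_term u))
  | tinv s => cpair 3 (code_term s)
  end.

Fixpoint code_form (phi : form) : nat :=
  match phi with
  | ffal => cpair 0 0
  | feq s u => cpair 1 (cpair (code_term s) (code_term u))
  | fimp p q => cpair 2 (cpair (code_form p) (code_form q))
  | fall p => cpair 3 (code_form p)
  end.

Definition decidable_set (T : form -> Prop) : Prop :=
  exists c : prf, forall phi,
    (T phi -> reval c [code_form phi] 1%nat) /\
    (~ T phi -> reval c [code_form phi] 0%nat).

Definition hereditarily_undecidable (T : form -> Prop) : Prop :=
  forall T', is_theory T' -> (forall phi, T' phi -> T phi) -> ~ decidable_set T'.

Definition Gelt (G : (R -> R) -> Prop) : Type :=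
  { p : (R -> R) * (R -> R) |
    G (fst p) /\ (forall x, snd p (fst p x) = x) /\ (forall x, fst p (snd p x) = x) }.

Section GStruct.
Variables (r : R) (G : (R -> R) -> Prop) (HG : is_subgroup_V r G).

Let Gid : G (fun x => x) := proj1 (proj2 HG).
Let Gcomp := proj1 (proj2 (proj2 HG)).
Let Ginv := proj2 (proj2 (proj2 HG)).

Definition G_one : Gelt G :=
  exist _ (fun x : R => x, fun x : R => x)
    (conj Gid (conj (fun x => eq_refl) (fun x => eq_refl))).

Definition G_mul (x y : Gelt G) : Gelt G.
Proof.
  destruct x as [[f f'] [Hf [Hf1 Hf2]]], y as [[g g'] [Hg [Hg1 Hg2]]].
  exists (fun t => g (f t), fun t => f' (g' t)); simpl in *.
  split; [apply Gcomp; assumption|split].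
  - intro t; rewrite Hg1; apply Hf1.
  - intro t; rewrite Hf2; apply Hg2.
Defined.

Definition G_inv (x : Gelt G) : Gelt G.
Proof.
  destruct x as [[f f'] [Hf [Hf1 Hf2]]].
  exists (f', f); simpl in *.
  split; [apply (Ginv f f'); assumption|split; assumption].
Defined.

Definition G_struct : structure := Structure (Gelt G) G_mul G_inv G_one.
End GStruct.

(* Main.v *)
Require Import Defs.
From Stdlib Require Import Reals List Arith Lia Lra Classical.
From Stdlib Require Import FunctionalExtensionality ProofIrrelevance.
Import ListNotations.
Open Scope R_scope.

(* Let [f] be a bump with support [(c, d)] whose only interior breakpoint makes
   its centralizer act on [(c, d)] as the powers of [f], let [w] map [(c, d)]
   into a fundamental domain of [f], and put [g = f^w]. The number [n] is
   represented by [g^(f^n)]; an element [u] moving exactly the positive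
   translates of the support of [g] makes the order definable. The conjugates
   [f^(w f^k w f^n)] have disjoint supports for distinct pairs [(n, k)], so a
   group element codes the set of pairs for which it does not commute with this
   conjugate, and every finite sequence of numbers is coded. In this way [G]
   satisfies, for suitable parameters, a finite set of axioms on numbers and
   finite sequences in which all recursive functions are representable; a
   decision procedure for a subtheory of [Th G] would then refute itself on the
   diagonal sentence. *)

(** * Recursive functions and their representability *)

Section Recursive_functions.
Local Open Scope nat_scope.

(** The obstacle is that elements of [G] may be discontinuous, with arbitrary positive slopes; the
    hypothesis controls only the continuous ones. So [f], [w], [u] are built from bumps with data in
    [Lam] and [A], and the sequence codes are products of conjugates formed from [f] and [w]. Of a
    general element commuting with [f] one uses injectivity and its affine germs at the two ends of
    [(c, d)], which commutation spreads inwards. As [f] has a single breakpoint inside its support,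
    the linear regime of [f] at [c] and that of its inverse at [d] overlap in a closed fundamental
    domain, where the two germs can be compared. A bump moves its whole support in one direction,
    whereas [w] must move both ends of [(c, d)] inwards; hence [w] is a product of two bumps. A
    subtheory of the theory of [G] need not contain the axioms on numbers, so these enter the
    diagonal sentence as an antecedent. *)

Definition p_add : prf := rPrec (rProj 0) (rComp rSucc [rProj 1]).
Definition p_tri : prf := rPrec rZero (rComp rSucc [rComp p_add [rProj 0; rProj 1]]).
Definition p_pair (a b : prf) : prf :=
  rComp (rComp p_add [rComp p_tri [p_add]; rProj 1]) [a; b].

Fixpoint p_const (n : nat) : prf :=
  match n with O => rZero | S m => rComp rSucc [p_const m] end.

Lemma reval_comp1 f g v x y :
  reval g v x -> reval f [x] y -> reval (rComp f [g]) v y.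
Proof. intros; eapply ev_comp; eauto; repeat constructor; auto. Qed.

Lemma reval_comp2 f g h v x x' y :
  reval g v x -> reval h v x' -> reval f [x; x'] y -> reval (rComp f [g; h]) v y.
Proof. intros; eapply ev_comp; eauto; repeat constructor; auto. Qed.

Lemma reval_proj i v x : nth_error v i = Some x -> reval (rProj i) v x.
Proof.
  intro H; rewrite <- (nth_error_nth _ _ 0 H); constructor.
  apply nth_error_Some; congruence.
Qed.

Lemma reval_const n v : reval (p_const n) v n.
Proof.
  induction n; simpl; [constructor|].
  eapply reval_comp1; eauto; constructor.
Qed.

Lemma reval_add x y : reval p_add [x; y] (x + y).
Proof.
  induction x; simpl.
  - apply ev_prec0, reval_proj; reflexivity.
  - eapply ev_precS; [exact IHx|].
    eapply reval_comp1; [apply reval_proj; reflexivity|constructor].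
Qed.

Fixpoint tri (n : nat) : nat := match n with O => 0 | S m => S (m + tri m) end.

Lemma tri_div n : n * (n + 1) / 2 = tri n.
Proof.
  assert (H : n * (n + 1) = tri n * 2) by (induction n; simpl in *; lia).
  rewrite H; apply Nat.div_mul; lia.
Qed.

Lemma reval_tri n : reval p_tri [n] (tri n).
Proof.
  induction n; simpl.
  - apply ev_prec0; constructor.
  - eapply ev_precS; [exact IHn|].
    eapply reval_comp1; [|constructor].
    eapply reval_comp2; [apply reval_proj; reflexivity..|apply reval_add].
Qed.

Lemma reval_pair a b v x y :
  reval a v x -> reval b v y -> reval (p_pair a b) v (cpair x y).
Proof.
  intros Ha Hb; unfold cpair; rewrite tri_div.
  eapply reval_comp2; eauto.
  eapply reval_comp2; [|apply reval_proj; reflexivity|apply reval_add].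
  eapply reval_comp1; [apply reval_add|apply reval_tri].
Qed.

Lemma prf_nested_ind (P : prf -> Prop) :
  P rZero -> P rSucc -> (forall i, P (rProj i)) ->
  (forall f gs, P f -> Forall P gs -> P (rComp f gs)) ->
  (forall f g, P f -> P g -> P (rPrec f g)) ->
  (forall f, P f -> P (rMu f)) ->
  forall c, P c.
Proof.
  intros H0 H1 H2 H3 H4 H5; fix IH 1; intros [| |i|f gs|f g|f].
  - exact H0.
  - exact H1.
  - apply H2.
  - apply H3; [apply IH|].
    induction gs as [|g gs IHgs]; constructor; [apply IH|exact IHgs].
  - apply H4; apply IH.
  - apply H5; apply IH.
Qed.

End Recursive_functions.

(** * Derived connectives and lifting of terms *)

Definition fnot (p : form) : form := fimp p ffal.
Definition fand (p q : form) : form := fnot (fimp p (fnot q)).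
Definition for_ (p q : form) : form := fimp (fnot p) q.
Definition fex (p : form) : form := fnot (fall (fnot p)).

Lemma sat_not M e p : sat M e (fnot p) <-> ~ sat M e p.
Proof. reflexivity. Qed.

Lemma sat_and M e p q : sat M e (fand p q) <-> sat M e p /\ sat M e q.
Proof. simpl; tauto. Qed.

Lemma sat_or M e p q : sat M e (for_ p q) <-> sat M e p \/ sat M e q.
Proof. simpl; tauto. Qed.

Lemma sat_ex M e p : sat M e (fex p) <-> exists x, sat M (scons x e) p.
Proof.
  simpl; split.
  - intro H; apply NNPP; intro H'; apply H; intros x Hx; apply H'; eauto.
  - intros [x Hx] H; exact (H x Hx).
Qed.

Lemma sat_imp M e p q : sat M e (fimp p q) <-> (sat M e p -> sat M e q).
Proof. reflexivity. Qed.

Lemma sat_all M e p : sat M e (fall p) <-> forall x, sat M (scons x e) p.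
Proof. reflexivity. Qed.

Fixpoint tlift (t : term) : term :=
  match t with
  | tvar n => tvar (S n)
  | tone => tone
  | tmul s u => tmul (tlift s) (tlift u)
  | tinv s => tinv (tlift s)
  end.

Lemma eval_tlift M e x t : eval_term M (scons x e) (tlift t) = eval_term M e t.
Proof. induction t; simpl; congruence. Qed.

Lemma term_below_tlift n t : term_below n t -> term_below (S n) (tlift t).
Proof. induction t; simpl; intuition lia. Qed.

(** * Numbers and sequences coded in a structure by four parameters *)

Record params (M : structure) : Type :=
  Params { pf : carrier M; pg : carrier M; pw : carrier M; pu : carrier M }.
Arguments pf {M}. Arguments pg {M}. Arguments pw {M}. Arguments pu {M}.

Definition env_params (M : structure) (e : nat -> carrier M) (k : nat) : params M :=
  Params M (e k) (e (S k)) (e (S (S k))) (e (S (S (S k)))).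

Section Coded_arithmetic.
Variable M : structure.

Definition conj_by (x y : carrier M) : carrier M := s_mul M (s_mul M (s_inv M y) x) y.
Definition commutes (x y : carrier M) : Prop := s_mul M x y = s_mul M y x.

Variable p : params M.

Definition succ (y : carrier M) : carrier M := conj_by y (pf p).

Fixpoint numeral (n : nat) : carrier M :=
  match n with O => pg p | S m => succ (numeral m) end.

(** In the intended model the first two clauses give the translates of [g] by all integer powers of
    [f]. The last clause keeps the positive ones; [g] is listed apart because it commutes with
    [u]. *)
Definition is_num (y : carrier M) : Prop :=
  exists x, commutes x (pf p) /\ y = conj_by (pg p) x /\
    (y = pg p \/ ~ commutes y (pu p)).

(** The element [x] plays the power of [f] that carries [y] to [z]; applying it to [g] and testing
    against [u] reveals whether the exponent is positive. *)
Definition num_lt (y z : carrier M) : Prop :=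
  exists x, commutes x (pf p) /\ z = conj_by y x /\ ~ commutes (conj_by (pg p) x) (pu p).

(** If [y] and [z] stand for [n] and [k], then [x] acts as [f^n] and the element tested against [s]
    is the conjugate of [f] attached to the pair [(n, k)]. *)
Definition entry (s y z : carrier M) : Prop :=
  exists x, commutes x (pf p) /\ y = conj_by (pg p) x /\
    ~ commutes s (conj_by (conj_by z (pw p)) x).

(** An element [s] codes an arbitrary set of pairs; the uniqueness clause reads it as a partial
    sequence. *)
Definition value (s y z : carrier M) : Prop :=
  entry s y z /\ forall z', is_num z' -> entry s y z' -> z' = z.

(** At [y] equal to zero the second clause is vacuous, so this also starts a sequence. Nothing is
    promised about indices above [y]. *)
Definition extendable : Prop :=
  forall s y z, is_num y -> is_num z -> exists s', value s' y z /\
    forall j a, is_num j -> is_num a -> num_lt j y -> value s j a -> value s' j a.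

(* A finitely axiomatized weak arithmetic of numbers and finite sequences,
   sufficient to represent recursive functions: any [s] is a sequence, whose
   [y]-th term is [z] when [value s y z]. *)
Record arith : Prop := Arith {
  num_zero : is_num (pg p);
  num_succ : forall y, is_num y -> is_num (succ y);
  lt_zero : forall y, is_num y -> ~ num_lt y (pg p);
  lt_succ_inv : forall y z, is_num y -> is_num z ->
    num_lt y (succ z) -> num_lt y z \/ y = z;
  lt_succ : forall y z, is_num y -> is_num z ->
    num_lt y z \/ y = z -> num_lt y (succ z);
  lt_irrefl : forall y, is_num y -> ~ num_lt y y;
  lt_total : forall y z, is_num y -> is_num z ->
    num_lt y z \/ y = z \/ num_lt z y;
  value_extend : extendable }.

Hypothesis Har : arith.

Lemma is_num_numeral n : is_num (numeral n).
Proof. induction n; simpl; [apply num_zero|apply num_succ]; auto. Qed.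

Lemma lt_numeral m n : (m < n)%nat -> num_lt (numeral m) (numeral n).
Proof.
  induction 1; simpl; apply lt_succ; auto using is_num_numeral.
Qed.

(** The axioms allow non-standard numbers; this is what confines every bounded search to standard
    ones. *)
Lemma lt_numeral_inv n y :
  is_num y -> num_lt y (numeral n) -> exists m, (m < n)%nat /\ y = numeral m.
Proof.
  intro Hy; induction n; simpl; intro H.
  - exfalso; exact (lt_zero Har y Hy H).
  - apply lt_succ_inv in H as [H| ->]; auto using is_num_numeral.
    + destruct (IHn H) as [m [Hm ->]]; exists m; auto.
    + exists n; auto.
Qed.

Lemma numeral_inj m n : numeral m = numeral n -> m = n.
Proof.
  intro H; destruct (Nat.lt_trichotomy m n) as [L|[E|L]]; auto; exfalso;
    apply lt_numeral in L; rewrite H in L;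
    exact (lt_irrefl Har _ (is_num_numeral _) L).
Qed.

Lemma succ_neq_zero y : is_num y -> succ y <> pg p.
Proof.
  intros Hy H; apply (lt_zero Har y Hy); rewrite <- H; apply lt_succ; auto.
Qed.

Lemma value_fun s y a b : is_num b -> value s y a -> value s y b -> b = a.
Proof. intros Hb [_ H] [H' _]; exact (H b Hb H'). Qed.

End Coded_arithmetic.

Arguments conj_by {M}. Arguments commutes {M}. Arguments succ {M}.
Arguments numeral {M}. Arguments is_num {M}. Arguments num_lt {M}.
Arguments entry {M}. Arguments value {M}. Arguments arith {M}.

(** * Formulas defining the coded arithmetic *)

Definition tconj (s t : term) : term := tmul (tmul (tinv t) s) t.
Definition f_comm (s t : term) : form := feq (tmul s t) (tmul t s).

(* In the formulas below the parameters are the variables [k], ..., [k + 3]. *)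
Definition f_num (k : nat) (t : term) : form :=
  fex (fand (f_comm (tvar 0) (tvar (S k)))
      (fand (feq (tlift t) (tconj (tvar (S (S k))) (tvar 0)))
            (for_ (feq (tlift t) (tvar (S (S k))))
                  (fnot (f_comm (tlift t) (tvar (S (S (S (S k)))))))))).

Definition f_lt (k : nat) (s t : term) : form :=
  fex (fand (f_comm (tvar 0) (tvar (S k)))
      (fand (feq (tlift t) (tconj (tlift s) (tvar 0)))
            (fnot (f_comm (tconj (tvar (S (S k))) (tvar 0)) (tvar (S (S (S (S k))))))))).

Definition f_entry (k : nat) (s y z : term) : form :=
  fex (fand (f_comm (tvar 0) (tvar (S k)))
      (fand (feq (tlift y) (tconj (tvar (S (S k))) (tvar 0)))
            (fnot (f_comm (tlift s)
               (tconj (tconj (tlift z) (tvar (S (S (S k))))) (tvar 0)))))).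

Definition f_value (k : nat) (s y z : term) : form :=
  fand (f_entry k s y z)
    (fall (fimp (f_num (S k) (tvar 0))
          (fimp (f_entry (S k) (tlift s) (tlift y) (tvar 0))
                (feq (tvar 0) (tlift z))))).

Definition f_zero (k : nat) : term := tvar (S k).
Definition f_succ (k : nat) (t : term) : term := tconj t (tvar k).

Lemma ex_congr {X : Type} (P Q : X -> Prop) :
  (forall x, P x <-> Q x) -> (exists x, P x) <-> (exists x, Q x).
Proof. firstorder. Qed.

Lemma all_congr {X : Type} (P Q : X -> Prop) :
  (forall x, P x <-> Q x) -> (forall x, P x) <-> (forall x, Q x).
Proof. firstorder. Qed.

Lemma sat_num M e k t :
  sat M e (f_num k t) <-> is_num (env_params M e k) (eval_term M e t).
Proof.
  unfold f_num; rewrite sat_ex; apply ex_congr; intro x.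
  rewrite !sat_and, sat_or, sat_not; cbn; rewrite !eval_tlift; reflexivity.
Qed.

Lemma sat_lt M e k s t :
  sat M e (f_lt k s t) <->
  num_lt (env_params M e k) (eval_term M e s) (eval_term M e t).
Proof.
  unfold f_lt; rewrite sat_ex; apply ex_congr; intro x.
  rewrite !sat_and, sat_not; cbn; rewrite !eval_tlift; reflexivity.
Qed.

Lemma sat_entry M e k s y z :
  sat M e (f_entry k s y z) <->
  entry (env_params M e k) (eval_term M e s) (eval_term M e y) (eval_term M e z).
Proof.
  unfold f_entry; rewrite sat_ex; apply ex_congr; intro x.
  rewrite !sat_and, sat_not; cbn; rewrite !eval_tlift; reflexivity.
Qed.

Lemma sat_value M e k s y z :
  sat M e (f_value k s y z) <->
  value (env_params M e k) (eval_term M e s) (eval_term M e y) (eval_term M e z).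
Proof.
  unfold f_value; rewrite sat_and, sat_entry, sat_all; apply and_iff_compat_l.
  apply all_congr; intro x.
  rewrite !sat_imp, sat_num, sat_entry; cbn [sat]; rewrite !eval_tlift; reflexivity.
Qed.

Definition f_arith (k : nat) : form :=
  fand (f_num k (f_zero k))
 (fand (fall (fimp (f_num (S k) (tvar 0)) (f_num (S k) (f_succ (S k) (tvar 0)))))
 (fand (fall (fimp (f_num (S k) (tvar 0)) (fnot (f_lt (S k) (tvar 0) (f_zero (S k))))))
 (fand (fall (fall (let k := S (S k) in
    fimp (f_num k (tvar 1)) (fimp (f_num k (tvar 0))
      (fimp (f_lt k (tvar 1) (f_succ k (tvar 0)))
            (for_ (f_lt k (tvar 1) (tvar 0)) (feq (tvar 1) (tvar 0))))))))
 (fand (fall (fall (let k := S (S k) in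
    fimp (f_num k (tvar 1)) (fimp (f_num k (tvar 0))
      (fimp (for_ (f_lt k (tvar 1) (tvar 0)) (feq (tvar 1) (tvar 0)))
            (f_lt k (tvar 1) (f_succ k (tvar 0))))))))
 (fand (fall (fimp (f_num (S k) (tvar 0)) (fnot (f_lt (S k) (tvar 0) (tvar 0)))))
 (fand (fall (fall (let k := S (S k) in
    fimp (f_num k (tvar 1)) (fimp (f_num k (tvar 0))
      (for_ (f_lt k (tvar 1) (tvar 0))
            (for_ (feq (tvar 1) (tvar 0)) (f_lt k (tvar 0) (tvar 1))))))))
 (fall (fall (fall (let k := S (S (S k)) in
    fimp (f_num k (tvar 1)) (fimp (f_num k (tvar 0))
      (fex (let k := S k in
        fand (f_value k (tvar 0) (tvar 2) (tvar 1))
        (fall (fall (let k := S (S k) in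
          fimp (f_num k (tvar 1)) (fimp (f_num k (tvar 0))
         (fimp (f_lt k (tvar 1) (tvar 4))
         (fimp (f_value k (tvar 5) (tvar 1) (tvar 0))
               (f_value k (tvar 2) (tvar 1) (tvar 0))))))))))))))))))))).

Ltac sat_unfold :=
  rewrite ?sat_and, ?sat_or, ?sat_not, ?sat_num, ?sat_lt, ?sat_value.

Lemma sat_arith M e k : sat M e (f_arith k) <-> arith (env_params M e k).
Proof.
  assert (E : forall P1 P2 P3 P4 P5 P6 P7 P8 Q1 Q2 Q3 Q4 Q5 Q6 Q7 Q8 : Prop,
    (P1 <-> Q1) -> (P2 <-> Q2) -> (P3 <-> Q3) -> (P4 <-> Q4) -> (P5 <-> Q5) ->
    (P6 <-> Q6) -> (P7 <-> Q7) -> (P8 <-> Q8) ->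
    (P1 /\ P2 /\ P3 /\ P4 /\ P5 /\ P6 /\ P7 /\ P8 <->
     Q1 /\ Q2 /\ Q3 /\ Q4 /\ Q5 /\ Q6 /\ Q7 /\ Q8)) by tauto.
  transitivity (let p := env_params M e k in
    is_num p (pg p) /\
    (forall y, is_num p y -> is_num p (succ p y)) /\
    (forall y, is_num p y -> ~ num_lt p y (pg p)) /\
    (forall y z, is_num p y -> is_num p z ->
       num_lt p y (succ p z) -> num_lt p y z \/ y = z) /\
    (forall y z, is_num p y -> is_num p z ->
       num_lt p y z \/ y = z -> num_lt p y (succ p z)) /\
    (forall y, is_num p y -> ~ num_lt p y y) /\
    (forall y z, is_num p y -> is_num p z ->
       num_lt p y z \/ y = z \/ num_lt p z y) /\
    extendable M p).
  2: { split; [intros (?&?&?&?&?&?&?&?); constructor|intros []; repeat split]; auto. }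
  unfold f_arith; rewrite !sat_and; apply E; clear E.
  - apply sat_num.
  - rewrite sat_all; apply all_congr; intro y; rewrite sat_imp; sat_unfold; reflexivity.
  - rewrite sat_all; apply all_congr; intro y; rewrite sat_imp; sat_unfold; reflexivity.
  - rewrite sat_all; apply all_congr; intro y; rewrite sat_all; apply all_congr; intro z; cbv zeta.
    rewrite !sat_imp; sat_unfold; reflexivity.
  - rewrite sat_all; apply all_congr; intro y; rewrite sat_all; apply all_congr; intro z; cbv zeta.
    rewrite !sat_imp; sat_unfold; reflexivity.
  - rewrite sat_all; apply all_congr; intro y; rewrite sat_imp; sat_unfold; reflexivity.
  - rewrite sat_all; apply all_congr; intro y; rewrite sat_all; apply all_congr; intro z; cbv zeta.
    rewrite !sat_imp; sat_unfold; reflexivity.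
  - rewrite sat_all; apply all_congr; intro s; rewrite sat_all; apply all_congr; intro y.
    rewrite sat_all; apply all_congr; intro z; cbv zeta.
    rewrite !sat_imp, sat_ex; sat_unfold.
    do 2 (apply imp_iff_compat_l); apply ex_congr; intro s'.
    sat_unfold; apply and_iff_compat_l.
    rewrite sat_all; apply all_congr; intro j; rewrite sat_all; apply all_congr; intro a.
    rewrite !sat_imp; sat_unfold; reflexivity.
Qed.

(** * Formulas representing recursive functions *)

Definition rel_builder : Type := nat -> list term -> term -> form.

Fixpoint f_comp (F : rel_builder) (Gs : list rel_builder)
    (k : nat) (vs acc : list term) (t : term) : form :=
  match Gs with
  | [] => F k acc t
  | G :: Gs' =>
      fex (fand (f_num (S k) (tvar 0))
          (fand (G (S k) (map tlift vs) (tvar 0))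
                (f_comp F Gs' (S k) (map tlift vs)
                        (map tlift acc ++ [tvar 0]) (tlift t))))
  end.

(** A coded sequence starts with the value of [F], passes from each term to the next by [G], and
    takes the value [t] at the recursion argument. The repeated liftings of [v] follow the binders
    crossed. *)
Definition f_prec (F G : rel_builder) (k : nat) (vs : list term) (t : term) : form :=
  match vs with
  | [] => ffal
  | n :: v =>
      let v1 := map tlift v in let v2 := map tlift v1 in
      let v4 := map tlift (map tlift v2) in
      fex (fand
        (fex (let k := S (S k) in
          fand (f_num k (tvar 0))
         (fand (F k v2 (tvar 0)) (f_value k (tvar 1) (f_zero k) (tvar 0)))))
       (fand
        (fall (fimp (f_num (S (S k)) (tvar 0))
              (fimp (f_lt (S (S k)) (tvar 0) (tlift (tlift n)))
          (fex (fex (let k := S (S (S (S k))) in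
            fand (f_num k (tvar 1))
           (fand (f_num k (tvar 0))
           (fand (f_value k (tvar 3) (tvar 2) (tvar 1))
           (fand (G k (tvar 2 :: tvar 1 :: v4) (tvar 0))
                 (f_value k (tvar 3) (f_succ k (tvar 2)) (tvar 0)))))))))))
        (f_value (S k) (tvar 0) (tlift n) (tlift t))))
  end.

Definition f_mu (F : rel_builder) (k : nat) (vs : list term) (t : term) : form :=
  fand (F k (t :: vs) (f_zero k))
  (fall (fimp (f_num (S k) (tvar 0)) (fimp (f_lt (S k) (tvar 0) (tlift t))
    (fex (fand (f_num (S (S k)) (tvar 0))
       (F (S (S k)) (tvar 1 :: map tlift (map tlift vs)) (f_succ (S (S k)) (tvar 0)))))))).

(** Arguments and result are passed as terms, so formulas are composed without substitution. The
    value [ffal] at argument lists that are too short matches the absence of an evaluation there. *)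
Fixpoint f_prf (c : prf) : rel_builder :=
  match c with
  | rZero => fun k vs t => feq t (f_zero k)
  | rSucc => fun k vs t =>
      match vs with [] => ffal | x :: _ => feq t (f_succ k x) end
  | rProj i => fun k vs t =>
      match nth_error vs i with Some x => feq t x | None => ffal end
  | rComp f gs => fun k vs t => f_comp (f_prf f) (map f_prf gs) k vs [] t
  | rPrec f g => f_prec (f_prf f) (f_prf g)
  | rMu f => f_mu (f_prf f)
  end.

Section Representability.
Variable M : structure.

(** The arguments are numerals but the result is any number of the structure, possibly non-standard;
    the equivalence thus contains uniqueness of the value. *)
Definition represents (F : rel_builder) (v : list nat) (n : nat) : Prop :=
  forall e k vs t, arith (env_params M e k) ->
    map (eval_term M e) vs = map (numeral (env_params M e k)) v ->
    is_num (env_params M e k) (eval_term M e t) ->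
    (sat M e (F k vs t) <-> eval_term M e t = numeral (env_params M e k) n).

Lemma map_eval_tlift e x vs :
  map (eval_term M (scons x e)) (map tlift vs) = map (eval_term M e) vs.
Proof. rewrite map_map; apply map_ext; intro; apply eval_tlift. Qed.

(** The accumulator holds the inner results already bound. Binding one more moves it from [ws] to
    [acc] and leaves [acc ++ ws], the argument list of [F], unchanged. *)
Lemma represents_comp gs v ws y acc F :
  Forall (fun g => forall v n, reval g v n -> represents (f_prf g) v n) gs ->
  revals gs v ws -> represents F (acc ++ ws) y ->
  forall e k vs ts t, arith (env_params M e k) ->
    map (eval_term M e) vs = map (numeral (env_params M e k)) v ->
    map (eval_term M e) ts = map (numeral (env_params M e k)) acc ->
    is_num (env_params M e k) (eval_term M e t) ->
    (sat M e (f_comp F (map f_prf gs) k vs ts t) <->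
     eval_term M e t = numeral (env_params M e k) y).
Proof.
  intro Hgs; revert ws acc; induction Hgs as [|g gs Hg _ IH];
    intros ws acc Hws HF e k vs ts t Har Hvs Hts Ht; inversion Hws; subst; cbn [map f_comp].
  - rewrite app_nil_r in HF; apply HF; auto.
  - match goal with H : reval g v ?w0, H' : revals gs v ?ws1 |- _ =>
      rename w0 into w, ws1 into ws', H into Hw, H' into Hws' end.
    replace (acc ++ w :: ws') with ((acc ++ [w]) ++ ws') in HF
      by (rewrite <- app_assoc; reflexivity).
    assert (step : forall x, is_num (env_params M e k) x ->
      x = numeral (env_params M e k) w ->
      (sat M (scons x e) (f_comp F (map f_prf gs) (S k) (map tlift vs)
         (map tlift ts ++ [tvar 0]) (tlift t)) <->
       eval_term M e t = numeral (env_params M e k) y)).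
    { intros x Hx Ex; rewrite <- (eval_tlift M e x t).
      apply (IH ws' (acc ++ [w]) Hws' HF (scons x e) (S k)); auto.
      - rewrite map_eval_tlift; exact Hvs.
      - rewrite !map_app, map_eval_tlift, Hts; simpl; rewrite Ex; reflexivity.
      - rewrite eval_tlift; exact Ht. }
    assert (Hg' : forall x, is_num (env_params M e k) x ->
      (sat M (scons x e) (f_prf g (S k) (map tlift vs) (tvar 0)) <->
       x = numeral (env_params M e k) w)).
    { intros x Hx; apply (Hg v w Hw (scons x e) (S k)); auto.
      rewrite map_eval_tlift; exact Hvs. }
    rewrite sat_ex; split.
    + intros [x Hx]; rewrite !sat_and, sat_num in Hx; destruct Hx as (Nx & Gx & Cx).
      apply (step x); auto; apply Hg'; auto.
    + intro E; exists (numeral (env_params M e k) w).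
      assert (Nw := is_num_numeral M _ Har w).
      rewrite !sat_and, sat_num; repeat split.
      * exact Nw.
      * apply Hg'; auto.
      * apply step; auto.
Qed.

(** The semantic content of [f_prec], abstracted from variables. The relations depend on [s] because
    the sequence belongs to the environment in which the subformulas are evaluated. *)
Definition prec_rel (p : params M) (Fv : carrier M -> carrier M -> Prop)
    (Gv : carrier M -> carrier M -> carrier M -> carrier M -> Prop) (n t : carrier M) : Prop :=
  exists s,
    (exists a, is_num p a /\ Fv s a /\ value p s (pg p) a) /\
    (forall i, is_num p i -> num_lt p i n ->
       exists a b, is_num p a /\ is_num p b /\ value p s i a /\
         Gv s i a b /\ value p s (succ p i) b) /\
    value p s n t.

Lemma finite_sequence (p : params M) (zs : nat -> nat) n : arith p ->
  exists s, forall i, (i <= n)%nat -> value p s (numeral p i) (numeral p (zs i)).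
Proof.
  intro Har; induction n as [|n [s Hs]].
  (* Any element can be extended at index zero; the first [pg p] is an arbitrary choice of sequence,
     the second is the index. *)
  - destruct (value_extend M p Har (pg p) (pg p) (numeral p (zs 0%nat))) as [s [Vs _]];
      auto using is_num_numeral, num_zero.
    exists s; intros i Hi; replace i with 0%nat by lia; exact Vs.
  - destruct (value_extend M p Har s (numeral p (S n)) (numeral p (zs (S n))))
      as [s' [Vs' Es']]; auto using is_num_numeral.
    exists s'; intros i Hi; destruct (Nat.eq_dec i (S n)) as [->|Ne]; [exact Vs'|].
    apply Es'; auto using is_num_numeral; [apply lt_numeral; auto; lia|apply Hs; lia].
Qed.

(** The coded sequence may be wild elsewhere, but an induction outside the structure forces its
    terms up to index [n]. Conversely, [finite_sequence] gives a witness, whose step condition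
    concerns only indices below the numeral [n], all of them numerals. *)
Lemma prec_rel_numeral (p : params M) Fv Gv (zs : nat -> nat) n :
  arith p ->
  (forall s a, is_num p a -> (Fv s a <-> a = numeral p (zs 0%nat))) ->
  (forall s i b, (i < n)%nat -> is_num p b ->
     (Gv s (numeral p i) (numeral p (zs i)) b <-> b = numeral p (zs (S i)))) ->
  forall t, is_num p t ->
    (prec_rel p Fv Gv (numeral p n) t <-> t = numeral p (zs n)).
Proof.
  intros Har HF HG t Ht; assert (Nm := is_num_numeral M p Har); split.
  - intros (s & (a & Na & Fa & Va) & Hs & Vt).
    assert (V : forall i, (i <= n)%nat -> value p s (numeral p i) (numeral p (zs i))).
    { induction i as [|i IH]; intro Hi.
      - apply HF in Fa; auto; subst a; exact Va.
      - destruct (Hs (numeral p i)) as (x & b & Nx & Nb & Vx & Gb & Vb); auto.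
        { apply lt_numeral; auto. }
        assert (Ex : x = numeral p (zs i)).
        { apply (value_fun M p s (numeral p i)); auto; apply IH; lia. }
        subst x; apply HG in Gb; auto; subst b; exact Vb. }
    exact (value_fun M p s _ _ _ Ht (V n (Nat.le_refl n)) Vt).
  - intros ->; destruct (finite_sequence p zs n Har) as [s Hs].
    exists s; split; [|split; [|apply Hs; auto]].
    + exists (numeral p (zs 0%nat)); split; [auto|split; [apply HF; auto|]].
      apply (Hs 0%nat); lia.
    + intros i Ni Li; destruct (lt_numeral_inv M p Har n i Ni Li) as [m [Lm ->]].
      exists (numeral p (zs m)), (numeral p (zs (S m))).
      split; [auto|split; [auto|split; [apply Hs; lia|split]]].
      * apply HG; auto.
      * apply (Hs (S m)); lia.
Qed.

Lemma sat_prec F G e k n v t :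
  sat M e (f_prec F G k (n :: v) t) <->
  prec_rel (env_params M e k)
    (fun s a => sat M (scons a (scons s e))
       (F (S (S k)) (map tlift (map tlift v)) (tvar 0)))
    (fun s i a b => sat M (scons b (scons a (scons i (scons s e))))
       (G (S (S (S (S k)))) (tvar 2 :: tvar 1 ::
          map tlift (map tlift (map tlift (map tlift v)))) (tvar 0)))
    (eval_term M e n) (eval_term M e t).
Proof.
  unfold f_prec, prec_rel; cbv zeta; rewrite sat_ex; apply ex_congr; intro s.
  rewrite !sat_and, sat_ex, sat_value; rewrite !eval_tlift.
  apply Morphisms_Prop.and_iff_morphism; [|apply and_iff_compat_r].
  - apply ex_congr; intro a; rewrite !sat_and, sat_num, sat_value; reflexivity.
  - rewrite sat_all; apply all_congr; intro i.
    rewrite !sat_imp, sat_num, sat_lt, sat_ex, !eval_tlift.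
    do 2 (apply imp_iff_compat_l); apply ex_congr; intro a; rewrite sat_ex.
    apply ex_congr; intro b; rewrite !sat_and, !sat_num, !sat_value; reflexivity.
Qed.

(** The trace [zs] of the computation is the sequence that the representing formula has to code. *)
Lemma reval_prec_inv f g n v y :
  reval (rPrec f g) (n :: v) y ->
  exists zs, zs n = y /\ reval f v (zs 0%nat) /\
    forall i, (i < n)%nat -> reval g (i :: zs i :: v) (zs (S i)).
Proof.
  revert y; induction n as [|n IH]; intros y H; inversion H; subst.
  - exists (fun _ => y); repeat split; auto; intros; lia.
  - match goal with H : reval (rPrec f g) (n :: v) _ |- _ =>
      apply IH in H as (zs & Ez & H0 & HS) end.
    exists (fun i => if Nat.eqb i (S n) then y else zs i); repeat split; auto.
    + rewrite Nat.eqb_refl; reflexivity.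
    + intros i Hi; replace (i =? S n)%nat with false
        by (symmetry; apply Nat.eqb_neq; lia).
      simpl; destruct (Nat.eqb_spec i n) as [->|Ne].
      * rewrite Ez; assumption.
      * apply HS; lia.
Qed.

Lemma represents_prec f g :
  (forall v n, reval f v n -> represents (f_prf f) v n) ->
  (forall v n, reval g v n -> represents (f_prf g) v n) ->
  forall v n, reval (rPrec f g) v n -> represents (f_prec (f_prf f) (f_prf g)) v n.
Proof.
  intros Hf Hg [|n v] y Hy; [inversion Hy|].
  intros e k [|tn vs] t Har Hvs Ht; try discriminate Hvs; injection Hvs as Etn Hvs.
  destruct (reval_prec_inv _ _ _ _ _ Hy) as (zs & <- & H0 & HS).
  rewrite sat_prec, Etn.
  apply prec_rel_numeral; auto.
  - intros s a Na; apply (Hf v _ H0 (scons a (scons s e)) (S (S k))); auto.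
    rewrite !map_eval_tlift; exact Hvs.
  - intros s i b Hi Nb.
    apply (Hg _ _ (HS i Hi) (scons b (scons _ (scons _ (scons s e)))) (S (S (S (S k)))));
      auto.
    simpl; rewrite !map_eval_tlift, Hvs; reflexivity.
Qed.

Lemma represents_mu f :
  (forall v n, reval f v n -> represents (f_prf f) v n) ->
  forall v n, reval (rMu f) v n -> represents (f_mu (f_prf f)) v n.
Proof.
  intros Hf v n Hn e k vs t Har Hvs Ht.
  set (p := env_params M e k) in *.
  inversion Hn as [| | | | | |f' v' n' H0 HS]; subst.
  assert (Nm : forall m, is_num p (numeral p m)) by (apply is_num_numeral; auto).
  assert (F0 : eval_term M e t = numeral p n -> sat M e (f_prf f k (t :: vs) (f_zero k))).
  { intro E; apply (Hf _ _ H0 e k); auto; [|apply (num_zero M p Har)].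
    simpl; rewrite Hvs, E; reflexivity. }
  assert (FS : forall x y m a, is_num p y -> x = numeral p m -> reval f (m :: v) a ->
    (sat M (scons y (scons x e)) (f_prf f (S (S k))
       (tvar 1 :: map tlift (map tlift vs)) (f_succ (S (S k)) (tvar 0))) <->
     succ p y = numeral p a)).
  { intros x y m a Ny Ex Ha.
    apply (Hf _ _ Ha (scons y (scons x e)) (S (S k))); auto.
    - simpl; rewrite !map_eval_tlift, Hvs, Ex; reflexivity.
    - exact (num_succ M p Har y Ny). }
  unfold f_mu; rewrite sat_and; split.
  - intros [Ft Hlt].
    (* Here [t] may be non-standard; comparing it with the standard value [n] is enough. Below [n]
       it would be a numeral at which [f] is positive, and above [n] minimality would make [f]
       positive at [n]. *)
    destruct (lt_total M p Har _ _ Ht (Nm n)) as [L|[E|L]]; [|exact E|]; exfalso.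
    + destruct (lt_numeral_inv M p Har _ _ Ht L) as [m [Lm Em]].
      destruct (HS m Lm) as [a Ha].
      apply (Hf _ _ Ha e k) in Ft; auto.
      * exact (succ_neq_zero M p Har _ (Nm a) (eq_sym Ft)).
      * simpl; rewrite Hvs, Em; reflexivity.
      * apply (num_zero M p Har).
    + specialize (Hlt (numeral p n)); rewrite !sat_imp, sat_num, sat_lt, sat_ex in Hlt.
      rewrite eval_tlift in Hlt; destruct (Hlt (Nm n) L) as [y Hy].
      rewrite sat_and, sat_num in Hy; destruct Hy as [Ny Fy].
      apply (FS _ _ n 0%nat) in Fy; auto.
      exact (succ_neq_zero M p Har _ Ny Fy).
  - intro E; split; [auto|].
    intro x; rewrite !sat_imp, sat_num, sat_lt, sat_ex, eval_tlift, E; intros Nx Lx.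
    destruct (lt_numeral_inv M p Har _ _ Nx Lx) as [m [Lm Em]].
    destruct (HS m Lm) as [a Ha].
    exists (numeral p a); rewrite sat_and, sat_num; split; [apply Nm|].
    apply (FS _ _ m (S a)); auto.
Qed.

Theorem represents_prf c v n : reval c v n -> represents (f_prf c) v n.
Proof.
  revert v n; induction c as [| |i|f gs IHf IHgs|f g IHf IHg|f IHf] using prf_nested_ind;
    intros v n H.
  - inversion H; subst; intros e k vs t _ _ _; reflexivity.
  - inversion H; subst; intros e k [|tx vs] t _ Hvs _; try discriminate Hvs.
    injection Hvs as Ex _; simpl; rewrite Ex; reflexivity.
  - inversion H; subst; intros e k vs t _ Hvs _; simpl.
    assert (E : nth_error (map (eval_term M e) vs) i =
                Some (numeral (env_params M e k) (nth i v 0%nat))).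
    { rewrite Hvs, nth_error_map, (nth_error_nth' v 0%nat) by assumption; reflexivity. }
    rewrite nth_error_map in E; destruct (nth_error vs i); [|discriminate].
    injection E as E; simpl; rewrite E; reflexivity.
  - inversion H as [| | |f' gs' v' ws y Hws Hy| | |]; subst.
    intros e k vs t Har Hvs Ht; simpl.
    apply (represents_comp gs v ws n []); auto.
  - apply represents_prec; auto.
  - apply represents_mu; auto.
Qed.

End Representability.

(** * Free variables of the representing formulas *)

Section Closedness.
Local Open Scope nat_scope.

(** The margin [k + 4] leaves room for the four parameters starting at variable [k]. *)
Definition below (F : rel_builder) : Prop :=
  forall n k vs t, k + 4 <= n -> Forall (term_below n) vs -> term_below n t ->
    form_below n (F k vs t).

Lemma Forall_below_tlift n vs :
  Forall (term_below n) vs -> Forall (term_below (S n)) (map tlift vs).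
Proof. induction 1; simpl; constructor; auto using term_below_tlift. Qed.

Ltac below_tac :=
  repeat match goal with
  | |- _ /\ _ => split
  | |- True => exact I
  | |- term_below _ (tlift _) => apply term_below_tlift
  end; simpl; auto; try lia.

Lemma below_num n k t : k + 4 <= n -> term_below n t -> form_below n (f_num k t).
Proof. intros; unfold f_num; simpl; below_tac. Qed.

Lemma below_lt n k s t :
  k + 4 <= n -> term_below n s -> term_below n t -> form_below n (f_lt k s t).
Proof. intros; unfold f_lt; simpl; below_tac. Qed.

Lemma below_value n k s y z :
  k + 4 <= n -> term_below n s -> term_below n y -> term_below n z ->
  form_below n (f_value k s y z).
Proof.
  intros; unfold f_value, f_entry; simpl; below_tac.
Qed.

Lemma below_f_arith : form_below 4 (f_arith 0).
Proof. unfold f_arith; simpl; below_tac. Qed.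


Lemma below_fand n p q : form_below n p -> form_below n q -> form_below n (fand p q).
Proof. simpl; tauto. Qed.

Lemma below_fex n p : form_below (S n) p -> form_below n (fex p).
Proof. simpl; tauto. Qed.

Lemma below_fall n p : form_below (S n) p -> form_below n (fall p).
Proof. auto. Qed.

Lemma below_fimp n p q : form_below n p -> form_below n q -> form_below n (fimp p q).
Proof. simpl; tauto. Qed.

Ltac below_split :=
  repeat match goal with
  | |- form_below _ (fand _ _) => apply below_fand
  | |- form_below _ (fex _) => apply below_fex
  | |- form_below _ (fimp _ _) => apply below_fimp
  | |- form_below _ (fall _) => apply below_fall
  end.

Lemma below_comp F Gs : below F -> Forall below Gs ->
  forall n k vs acc t, k + 4 <= n -> Forall (term_below n) vs ->
    Forall (term_below n) acc -> term_below n t ->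
    form_below n (f_comp F Gs k vs acc t).
Proof.
  intros HF HGs; induction HGs as [|G Gs HG _ IH]; intros n k vs acc t Hk Hvs Hacc Ht.
  - apply HF; auto.
  - cbn [f_comp]; below_split.
    + apply below_num; simpl; lia.
    + apply HG; auto using Forall_below_tlift; simpl; lia.
    + apply IH; auto using Forall_below_tlift, term_below_tlift; [lia|].
      apply Forall_app; split; auto using Forall_below_tlift.
      constructor; [simpl; lia|constructor].
Qed.

Lemma below_prec F G : below F -> below G -> below (f_prec F G).
Proof.
  intros HF HG n k [|m v] t Hk Hvs Ht; [exact I|]; inversion Hvs; subst.
  unfold f_prec; cbv zeta; below_split;
    first [apply below_num | apply below_lt | apply below_value | apply HF | apply HG];
    auto 10 using Forall_below_tlift, term_below_tlift; simpl; auto; try lia.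
  repeat constructor; auto 10 using Forall_below_tlift; simpl; lia.
Qed.

Lemma below_mu F : below F -> below (f_mu F).
Proof.
  intros HF n k vs t Hk Hvs Ht.
  unfold f_mu; below_split;
    first [apply below_num | apply below_lt | apply HF];
    auto using Forall_below_tlift, term_below_tlift; simpl; auto; try lia.
  constructor; auto using Forall_below_tlift; simpl; lia.
Qed.

Lemma below_f_prf c : below (f_prf c).
Proof.
  induction c as [| |i|f gs IHf IHgs|f g IHf IHg|f IHf] using prf_nested_ind.
  - intros n k vs t Hk Hvs Ht; simpl; split; [auto|lia].
  - intros n k [|x vs] t Hk Hvs Ht; simpl; auto.
    inversion Hvs; subst; intuition lia.
  - intros n k vs t Hk Hvs Ht; simpl.
    destruct (nth_error vs i) eqn:E; simpl; auto; split; auto.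
    apply nth_error_In in E; rewrite Forall_forall in Hvs; auto.
  - intros n k vs t Hk Hvs Ht; simpl; apply below_comp; auto.
    clear -IHgs; induction IHgs; simpl; constructor; auto.
  - apply below_prec; auto.
  - apply below_mu; auto.
Qed.

End Closedness.

(** * The diagonal sentence *)

Section Undecidability.
Local Open Scope nat_scope.

(** Variable 0 is reserved for the argument of the diagonal formula, so the parameters begin at 1:
    [tvar 1] is [f] and [tvar 2] is [g]. *)
Fixpoint num_term (n : nat) : term :=
  match n with O => tvar 2 | S m => tconj (num_term m) (tvar 1) end.

Lemma eval_num_term M e n :
  eval_term M e (num_term n) = numeral (env_params M e 1) n.
Proof. induction n; simpl; [reflexivity|]; rewrite IHn; reflexivity. Qed.

Lemma below_num_term n : term_below 5 (num_term n).
Proof. induction n; simpl; intuition lia. Qed.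

(* [m] occurs twice: as the numeral and, when [m] is the code of [psi], as the
   code of the conclusion, so that coding the diagonal instance needs no
   substitution. *)
Definition diag (chi : form) (m : nat) (psi : form) : form :=
  fall (fall (fall (fall (fimp chi
    (fall (fimp (feq (tvar 0) (num_term m)) psi)))))).

Lemma sentence_diag chi m psi :
  form_below 4 chi -> form_below 5 psi -> sentence (diag chi m psi).
Proof.
  intros Hchi Hpsi; unfold sentence, diag; simpl; repeat split; auto; try lia.
  apply below_num_term.
Qed.

Definition p_num_term : prf :=
  rPrec (p_const (code_term (tvar 2)))
    (p_pair (p_const 2) (p_pair (p_pair (p_const 2)
       (p_pair (p_const (code_term (tinv (tvar 1)))) (rProj 1)))
       (p_const (code_term (tvar 1))))).

Lemma reval_num_term n : reval p_num_term [n] (code_term (num_term n)).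
Proof.
  induction n as [|n IH]; [apply ev_prec0, reval_const|].
  eapply ev_precS; [exact IH|].
  change (code_term (num_term (S n))) with
    (cpair 2 (cpair (cpair 2 (cpair (code_term (tinv (tvar 1)))
       (code_term (num_term n)))) (code_term (tvar 1)))).
  repeat apply reval_pair; try apply reval_const; apply reval_proj; reflexivity.
Qed.

Definition p_diag (c : nat) : prf :=
  let all := p_pair (p_const 3) in
  all (all (all (all (p_pair (p_const 2) (p_pair (p_const c)
    (all (p_pair (p_const 2) (p_pair
      (p_pair (p_const 1) (p_pair (p_const (code_term (tvar 0))) p_num_term))
      (rProj 0))))))))).

Lemma reval_diag chi psi :
  reval (p_diag (code_form chi)) [code_form psi]
        (code_form (diag chi (code_form psi) psi)).
Proof.
  set (m := code_form psi) at 1 2.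
  change (code_form (diag chi m psi)) with
    (cpair 3 (cpair 3 (cpair 3 (cpair 3 (cpair 2 (cpair (code_form chi)
       (cpair 3 (cpair 2 (cpair (cpair 1 (cpair (code_term (tvar 0))
          (code_term (num_term m)))) m))))))))).
  unfold p_diag; cbv zeta.
  repeat apply reval_pair; try apply reval_const.
  - apply reval_num_term.
  - apply reval_proj; reflexivity.
Qed.

Lemma sat_vanishing q m y (N : structure) (e : nat -> carrier N) :
  reval q [m] y -> arith (env_params N e 1) ->
  e 0 = numeral (env_params N e 1) m ->
  (sat N e (f_prf q 1 [tvar 0] (f_zero 1)) <->
   pg (env_params N e 1) = numeral (env_params N e 1) y).
Proof.
  intros Hy Har E0; apply (represents_prf N q [m] y Hy e 1); auto.
  - simpl; rewrite E0; reflexivity.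
  - apply (num_zero N _ Har).
Qed.

(** With the axioms as antecedent of [S0], accepting [S0] would make it false in [M], while
    rejecting it makes it true in all structures and hence a member of every theory. This works for
    subtheories that prove none of the axioms. *)
Theorem hereditarily_undecidable_arith (M : structure) (p : params M) :
  arith p -> hereditarily_undecidable (Th M).
Proof.
  intros Hp T' [Tsent [_ Tcons]] Tsub [c Hc].
  (* The codes are huge numbers: they are kept opaque to prevent their evaluation. *)
  destruct (ex_intro (fun C => C = code_form (f_arith 0)) _ eq_refl) as [C EC].
  set (q := rComp c [p_diag C]).
  set (psi := f_prf q 1 [tvar 0] (f_zero 1)).
  destruct (ex_intro (fun m => m = code_form psi) _ eq_refl) as [m Em].
  set (S0 := diag (f_arith 0) m psi).
  assert (Hq : forall y, reval c [code_form S0] y -> reval q [m] y).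
  { intros y Hy; apply reval_comp1 with (2 := Hy); unfold S0.
    rewrite EC, Em; apply reval_diag. }
  destruct (Hc S0) as [Hin Hout].
  (* Acceptance makes [q] return 1 at [m]; the truth of [S0] in [M] would then identify the numerals
     0 and 1. *)
  assert (HnT : ~ T' S0).
  { intro HT; assert (H1 := Hq _ (Hin HT)).
    destruct (Tsub _ HT) as [_ HM].
    specialize (HM (pu p) (pw p) (pg p) (pf p)).
    set (e := scons (pf p) _) in HM.
    assert (Har : arith (env_params M e 0)) by (destruct p; exact Hp).
    specialize (HM (proj2 (sat_arith M e 0) Har) (numeral (env_params M e 0) m)).
    assert (E0 : pg (env_params M e 0) = numeral (env_params M e 0) 1).
    { apply (sat_vanishing q m 1 M (scons (numeral (env_params M e 0) m) e) H1 Har eq_refl), HM.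
      simpl sat; rewrite eval_num_term; reflexivity. }
    apply (numeral_inj M _ Har 0 1) in E0; discriminate E0. }
  (* Rejection makes [q] return 0 at [m]. Representability holds wherever the axioms do, so [S0] is
     logically valid and closure puts it back into [T']. *)
  apply HnT, Tcons.
  - apply sentence_diag; [apply below_f_arith|].
    apply below_f_prf; [apply Nat.le_refl|repeat constructor; simpl; lia|simpl; lia].
  - intros N _ u w g f Har x Ex.
    set (e := scons f _) in Har, Ex.
    apply sat_arith in Har.
    simpl sat in Ex; rewrite eval_num_term in Ex.
    exact (proj2 (sat_vanishing q m 0 N (scons x e) (Hq _ (Hout HnT)) Har Ex) eq_refl).
Qed.

End Undecidability.

(** * Arithmetic in a group *)

Record is_group (M : structure) : Prop := {
  mulA : forall x y z, s_mul M x (s_mul M y z) = s_mul M (s_mul M x y) z;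
  mul1g : forall x, s_mul M (s_one M) x = x;
  mulg1 : forall x, s_mul M x (s_one M) = x;
  mulVg : forall x, s_mul M (s_inv M x) x = s_one M;
  mulgV : forall x, s_mul M x (s_inv M x) = s_one M }.

Section Group_conjugation.
Variable M : structure.
Hypothesis HM : is_group M.
Local Notation "x ** y" := (s_mul M x y) (at level 40, left associativity).

Lemma mulgK (x y : carrier M) : x ** y ** s_inv M y = x.
Proof. rewrite <- (mulA M HM), (mulgV M HM); apply mulg1, HM. Qed.

Lemma mulgVK (x y : carrier M) : x ** s_inv M y ** y = x.
Proof. rewrite <- (mulA M HM), (mulVg M HM); apply mulg1, HM. Qed.

Lemma mulIg (x y z : carrier M) : x ** z = y ** z -> x = y.
Proof. intro H; rewrite <- (mulgK x z), H; apply mulgK. Qed.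

Lemma mulgI (x y z : carrier M) : z ** x = z ** y -> x = y.
Proof.
  intro H; rewrite <- (mul1g M HM x), <- (mulVg M HM z), <- (mulA M HM), H,
    (mulA M HM), (mulVg M HM); apply mul1g, HM.
Qed.

Lemma invMg (x y : carrier M) : s_inv M (x ** y) = s_inv M y ** s_inv M x.
Proof.
  apply (mulIg _ _ (x ** y)); rewrite (mulVg M HM), (mulA M HM), mulgVK.
  symmetry; apply mulVg, HM.
Qed.

Lemma conj_by_mul (x y a : carrier M) : conj_by (x ** y) a = conj_by x a ** conj_by y a.
Proof.
  unfold conj_by; rewrite !(mulA M HM), mulgK; reflexivity.
Qed.

Lemma conj_by_conj (x a b : carrier M) : conj_by (conj_by x a) b = conj_by x (a ** b).
Proof. unfold conj_by; rewrite invMg, !(mulA M HM); reflexivity. Qed.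

Lemma conj_by_inj (x y a : carrier M) : conj_by x a = conj_by y a -> x = y.
Proof. intro H; apply mulIg in H; apply mulgI in H; exact H. Qed.

Lemma conj_by_one (x : carrier M) : conj_by x (s_one M) = x.
Proof.
  unfold conj_by; rewrite (mulg1 M HM); apply (mulgI _ _ (s_one M)).
  rewrite (mulA M HM), (mulgV M HM), (mul1g M HM); reflexivity.
Qed.

Lemma conj_by_fixed (x a : carrier M) : commutes x a -> conj_by x a = x.
Proof.
  intro H; unfold conj_by; rewrite <- (mulA M HM), H, (mulA M HM), (mulVg M HM).
  apply mul1g, HM.
Qed.

Lemma commutes_sym (x y : carrier M) : commutes x y -> commutes y x.
Proof. exact (@eq_sym _ _ _). Qed.

Lemma commutes_conj (x y a : carrier M) : commutes (conj_by x a) (conj_by y a) <-> commutes x y.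
Proof.
  unfold commutes; rewrite <- !conj_by_mul; split; [apply conj_by_inj|congruence].
Qed.

Lemma commutes_one_l (x : carrier M) : commutes (s_one M) x.
Proof. unfold commutes; rewrite (mul1g M HM), (mulg1 M HM); reflexivity. Qed.

Lemma commutes_mul_r (x y z : carrier M) : commutes y z -> (commutes (x ** y) z <-> commutes x z).
Proof.
  unfold commutes; intro H; rewrite <- (mulA M HM), H, !(mulA M HM); split.
  - apply mulIg.
  - congruence.
Qed.

Lemma commutes_mul_l (x y z : carrier M) : commutes x z -> (commutes (x ** y) z <-> commutes y z).
Proof.
  unfold commutes; intro H; rewrite (mulA M HM), <- H, <- !(mulA M HM); split.
  - apply mulgI.
  - congruence.
Qed.

End Group_conjugation.

Definition iter_conj {M : structure} (f : carrier M) (n : nat) (q : carrier M) :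
  carrier M := Nat.iter n (fun q => conj_by q f) q.

(* The algebraic shadow of the dynamics: [local q] says that [q] is supported in
   the support of [f], on which the centralizer of [f] acts by powers of [f];
   [w] maps this support into a fundamental domain of [f]; and [u] separates the
   positive translates of that domain from the others. *)
Record arithmetic_data (M : structure) (f w u : carrier M)
    (local : carrier M -> Prop) : Prop := {
  local_f : local f;
  local_conj_f : forall q, local q -> local (conj_by q f);
  local_conj_w : forall q, local q -> local (conj_by q w);
  centralizer_f : forall x, commutes x f -> exists n,
    (forall q, local q -> conj_by q x = iter_conj f n q) \/
    (forall q, local q -> iter_conj f n (conj_by q x) = q);
  translates_commute : forall n q q', (0 < n)%nat -> local q -> local q' ->
    commutes (iter_conj f n (conj_by q w)) (conj_by q' w);
  positive_translate : forall n, (0 < n)%nat ->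
    ~ commutes (iter_conj f n (conj_by f w)) u;
  negative_translate : forall n q, iter_conj f n q = conj_by f w -> commutes q u }.

Arguments local_f {M f w u local}.
Arguments local_conj_f {M f w u local}.
Arguments local_conj_w {M f w u local}.
Arguments centralizer_f {M f w u local}.
Arguments translates_commute {M f w u local}.
Arguments positive_translate {M f w u local}.
Arguments negative_translate {M f w u local}.

Section Arithmetic_in_group.
Local Open Scope nat_scope.
Variable M : structure.
Hypothesis HM : is_group M.
Variables (f w u : carrier M) (local : carrier M -> Prop).
Hypothesis HD : arithmetic_data M f w u local.

Let g : carrier M := conj_by f w.
Let p : params M := Params M f g w u.
Let ic := iter_conj f.

Lemma numeral_iter n : numeral p n = ic n g.
Proof. induction n; simpl; [reflexivity|]; rewrite IHn; reflexivity. Qed.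

Lemma iter_conj_add m n q : ic (m + n) q = ic m (ic n q).
Proof. apply Nat.iter_add. Qed.

(** The power [f^n] as a single element, the witness for the quantifiers over the centralizer. *)
Lemma iter_conj_pow n : exists x, commutes x f /\ forall q, conj_by q x = ic n q.
Proof.
  induction n as [|n [x [Cx Hx]]].
  - exists (s_one M); split; [apply commutes_one_l, HM|apply conj_by_one, HM].
  - exists (s_mul M x f); split.
    + apply (commutes_mul_l M HM); [exact Cx|reflexivity].
    + intro q; rewrite <- (conj_by_conj M HM), Hx; reflexivity.
Qed.

Lemma iter_conj_inj n q q' : ic n q = ic n q' -> q = q'.
Proof.
  destruct (iter_conj_pow n) as [x [_ Hx]]; rewrite <- !Hx; apply conj_by_inj, HM.
Qed.

Lemma iter_conj_commutes n q q' : commutes (ic n q) (ic n q') <-> commutes q q'.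
Proof.
  destruct (iter_conj_pow n) as [x [_ Hx]]; rewrite <- !Hx; apply commutes_conj, HM.
Qed.

Lemma local_iter n q : local q -> local (ic n q).
Proof. intro H; induction n; simpl; [exact H|]; apply (local_conj_f HD), IHn. Qed.

Lemma local_g : local g.
Proof. apply (local_conj_w HD), (local_f HD). Qed.

Lemma numeral_add m n : numeral p (m + n) = ic m (numeral p n).
Proof. rewrite !numeral_iter; apply iter_conj_add. Qed.

(** Two equal numerals would make a positive translate of [g] equal to [g]; but [g] commutes with
    [u] and its positive translates do not. *)
Lemma group_numeral_inj m n : numeral p m = numeral p n -> m = n.
Proof.
  assert (W : forall a b, a < b -> numeral p a <> numeral p b).
  { intros a b L E; apply (positive_translate HD (b - a)); [lia|].
    apply (negative_translate HD 0); simpl.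
    apply (iter_conj_inj a); change (ic a (ic (b - a) g) = ic a g).
    rewrite <- iter_conj_add, <- !numeral_iter, E; f_equal; lia. }
  intro E; destruct (Nat.lt_trichotomy m n) as [L|[L|L]]; auto; exfalso.
  - exact (W _ _ L E).
  - exact (W _ _ L (eq_sym E)).
Qed.

Lemma is_num_iff y : is_num p y <-> exists n, y = numeral p n.
Proof.
  split.
  - intros (x & Cx & -> & [E|NC]); simpl in *; [exists 0; exact E|].
    destruct (centralizer_f HD x Cx) as [n [H|H]].
    + exists n; rewrite numeral_iter; apply H, local_g.
    + exfalso; apply NC, (negative_translate HD n), H, local_g.
  - intros [n ->]; destruct (iter_conj_pow n) as [x [Cx Hx]].
    exists x; split; [exact Cx|split; [rewrite numeral_iter; symmetry; apply Hx|]].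
    destruct n as [|n]; [left; reflexivity|right].
    rewrite numeral_iter; apply (positive_translate HD); lia.
Qed.

Lemma num_lt_iff m n : num_lt p (numeral p m) (numeral p n) <-> m < n.
Proof.
  split.
  - intros (x & Cx & E & NC); simpl in *.
    destruct (centralizer_f HD x Cx) as [k [H|H]].
    + rewrite H in E by (rewrite numeral_iter; apply local_iter, local_g).
      fold ic in E; rewrite <- numeral_add in E; apply group_numeral_inj in E.
      destruct k as [|k]; [|lia]; exfalso; apply NC.
      rewrite (H g local_g); apply (negative_translate HD 0); reflexivity.
    + exfalso; apply NC, (negative_translate HD k), H, local_g.
  - intro L; destruct (iter_conj_pow (n - m)) as [x [Cx Hx]].
    exists x; split; [exact Cx|split; simpl; rewrite Hx].
    + rewrite <- numeral_add; f_equal; lia.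
    + apply (positive_translate HD); lia.
Qed.

(** This is [q] conjugated by [w f^k w f^n]. With [q = f] it tests the pair [(n, k)]; with [q = g]
    it is the factor that records the pair. *)
Definition cell (n k : nat) (q : carrier M) : carrier M :=
  ic n (conj_by (ic k (conj_by q w)) w).

Lemma entry_iff s n k :
  entry p s (numeral p n) (numeral p k) <-> ~ commutes s (cell n k f).
Proof.
  unfold cell; fold g; rewrite <- numeral_iter; split.
  - intros (x & Cx & E & NC); simpl in *.
    destruct (centralizer_f HD x Cx) as [m [H|H]].
    + rewrite H in E by apply local_g; fold ic in E; rewrite <- numeral_iter in E.
      apply group_numeral_inj in E; subst m; rewrite H in NC; [exact NC|].
      rewrite numeral_iter; apply (local_conj_w HD), local_iter, local_g.
    (* If [x] acts as [f^-m], then translating the numeral [n] by [f^m] gives [g], so [m] and [n]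
       are both zero and [x] acts trivially on local elements. *)
    + assert (E' := H g local_g); rewrite <- E in E'; fold ic in E'.
      rewrite <- numeral_add in E'; apply (group_numeral_inj _ 0) in E'.
      replace m with 0 in H by lia; replace n with 0 by lia; simpl in *.
      rewrite H in NC; [exact NC|].
      rewrite numeral_iter; apply (local_conj_w HD), local_iter, local_g.
  - intro NC; destruct (iter_conj_pow n) as [x [Cx Hx]].
    exists x; simpl; rewrite !Hx, <- numeral_iter; auto.
Qed.

Lemma value_iff s n k :
  value p s (numeral p n) (numeral p k) <->
  forall j, ~ commutes s (cell n j f) <-> j = k.
Proof.
  split.
  - intros [E U] j; rewrite <- entry_iff; split; [|intros ->; exact E].
    intro H; apply group_numeral_inj, U; [apply is_num_iff; eauto|exact H].
  - intro H; split; [apply entry_iff, H; reflexivity|].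
    intros z Nz Ez; apply is_num_iff in Nz as [j ->]; f_equal.
    apply H, entry_iff, Ez.
Qed.

Lemma translates_commute_neq m n q q' : m <> n -> local q -> local q' ->
  commutes (ic m (conj_by q w)) (ic n (conj_by q' w)).
Proof.
  assert (W : forall a b q q', a < b -> local q -> local q' ->
    commutes (ic b (conj_by q w)) (ic a (conj_by q' w))).
  { intros a b r r' L Hr Hr'.
    replace b with (a + (b - a)) by lia; rewrite iter_conj_add.
    apply iter_conj_commutes, (translates_commute HD); auto; lia. }
  intros Ne Hq Hq'; destruct (Nat.lt_gt_cases m n) as [H _].
  destruct (H Ne); [apply commutes_sym|]; auto.
Qed.

(** Different [n] are separated by the outer translation. For equal [n] the outer conjugation
    cancels and different [k] are separated by the inner one. *)
Lemma cells_commute n k n' k' q q' : (n, k) <> (n', k') -> local q -> local q' ->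
  commutes (cell n k q) (cell n' k' q').
Proof.
  intros Ne Hq Hq'; unfold cell.
  destruct (Nat.eq_dec n n') as [<-|Nn].
  - assert (Nk : k <> k') by congruence.
    apply iter_conj_commutes; apply (commutes_conj M HM).
    apply translates_commute_neq; auto.
  - apply translates_commute_neq; auto; apply local_iter;
      apply (local_conj_w HD); auto.
Qed.

(** Undoing the common conjugation leaves [g] and [f], which do not commute because [g^f] is the
    numeral 1. *)
Lemma cell_noncommuting n k : ~ commutes (cell n k g) (cell n k f).
Proof.
  unfold cell; rewrite iter_conj_commutes, (commutes_conj M HM), iter_conj_commutes,
    (commutes_conj M HM); intro C.
  assert (E : numeral p 1 = numeral p 0) by (apply (conj_by_fixed M HM), C).
  apply group_numeral_inj in E; discriminate E.
Qed.

(** The code is a product with one factor [cell j a g] for each index [j] below [n] that has a value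
    [a]; such a factor affects the test of its own pair only. The second conclusion keeps the later
    indices empty for the induction. *)
Lemma finite_assignment (P : nat -> nat -> Prop) n :
  (forall j a b, P j a -> P j b -> a = b) ->
  exists s, (forall j k, j < n -> (~ commutes s (cell j k f) <-> P j k)) /\
    (forall j k, n <= j -> commutes s (cell j k f)).
Proof.
  intro HP; induction n as [|n [s [Hs Hs']]].
  - exists (s_one M); split; [intros; lia|intros; apply commutes_one_l, HM].
  - destruct (classic (exists a, P n a)) as [[a Ha]|Hn].
    + exists (s_mul M s (cell n a g)).
      assert (C : forall j k, (j, k) <> (n, a) ->
        (commutes (s_mul M s (cell n a g)) (cell j k f) <-> commutes s (cell j k f))).
      { intros j k Ne; apply (commutes_mul_r M HM), cells_commute;
          auto using local_g; exact (local_f HD). }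
      split; [|intros; rewrite C; [apply Hs'; lia|injection; lia]].
      intros j k Hj; destruct (Nat.eq_dec j n) as [->|Ne].
      * destruct (Nat.eq_dec k a) as [->|Nk].
        -- split; [auto|intros _].
           rewrite (commutes_mul_l M HM); [apply cell_noncommuting|apply Hs'; lia].
        -- rewrite C by congruence; split.
           ++ intro NC; destruct NC; apply Hs'; lia.
           ++ intro H; destruct Nk; exact (HP _ _ _ H Ha).
      * rewrite C by congruence; apply Hs; lia.
    + exists s; split; [|intros; apply Hs'; lia].
      intros j k Hj; destruct (Nat.eq_dec j n) as [->|Ne]; [|apply Hs; lia].
      split; intro H; exfalso; [apply H, Hs'; lia|eauto].
Qed.

Theorem group_arith : arith p.
Proof.
  constructor.
  - apply is_num_iff; exists 0; reflexivity.
  - intros y Hy; apply is_num_iff in Hy as [n ->]; apply is_num_iff; exists (S n).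
    reflexivity.
  - intros y Hy; apply is_num_iff in Hy as [n ->]; intro L.
    apply (num_lt_iff n 0) in L; lia.
  - intros y z Hy Hz L; apply is_num_iff in Hy as [m ->]; apply is_num_iff in Hz as [n ->].
    apply (num_lt_iff m (S n)) in L; rewrite num_lt_iff.
    destruct (Nat.eq_dec m n) as [->|Ne]; [right; reflexivity|left; lia].
  - intros y z Hy Hz L; apply is_num_iff in Hy as [m ->]; apply is_num_iff in Hz as [n ->].
    apply (num_lt_iff m (S n)); rewrite num_lt_iff in L.
    destruct L as [L|L]; [|apply group_numeral_inj in L]; lia.
  - intros y Hy; apply is_num_iff in Hy as [n ->]; rewrite num_lt_iff; lia.
  - intros y z Hy Hz; apply is_num_iff in Hy as [m ->]; apply is_num_iff in Hz as [n ->].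
    rewrite !num_lt_iff; destruct (Nat.lt_trichotomy m n) as [L|[->|L]]; auto.
  - intros s y z Hy Hz; apply is_num_iff in Hy as [m ->]; apply is_num_iff in Hz as [n ->].
    (* The new sequence copies the values of [s] below [m], puts [n] at index [m], and stays empty
       where [s] has no value. *)
    destruct (finite_assignment (fun j a =>
      j < m /\ value p s (numeral p j) (numeral p a) \/ j = m /\ a = n) (S m)) as [s' [Hs' _]].
    { intros j a b [[La Ha]|[Ea Ha]] [[Lb Hb]|[Eb Hb]]; try lia.
      apply group_numeral_inj, (value_fun M p s (numeral p j)); auto.
      apply is_num_iff; eauto. }
    exists s'; split.
    + apply value_iff; intro k; rewrite Hs' by lia; split; intros; lia.
    + intros j a Hj Ha L V; apply is_num_iff in Hj as [j' ->].
      apply is_num_iff in Ha as [a' ->]; apply num_lt_iff in L.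
      apply value_iff; intro k; rewrite Hs' by lia; split.
      * intros [[_ V']|[E _]]; [|lia].
        apply group_numeral_inj, (value_fun M p s (numeral p j')); auto.
        apply is_num_iff; eauto.
      * intros ->; left; auto.
Qed.

End Arithmetic_in_group.

(** * Bump functions *)

(** Slope [l] on a piece of length [s], then slope [/ l] on a piece of length [l * s]: the image
    pieces have these lengths exchanged, so the map closes up and its inverse has the same shape
    with [l * s] and [/ l]. *)
Definition bump (c s l x : R) : R :=
  if Rle_dec x c then x
  else if Rle_dec x (c + s) then c + l * (x - c)
  else if Rle_dec x (c + s + l * s) then c + l * s + (x - c - s) / l
  else x.

Section Bump.
Variables c s l : R.
Hypotheses (hs : 0 < s) (hl : 0 < l).

Lemma bump_lo x : x <= c -> bump c s l x = x.
Proof. intro H; unfold bump; destruct (Rle_dec x c); lra. Qed.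

Lemma bump_left x : c <= x <= c + s -> bump c s l x = c + l * (x - c).
Proof.
  intro H; unfold bump; destruct (Rle_dec x c); [replace x with c by lra; lra|].
  destruct (Rle_dec x (c + s)); lra.
Qed.

Lemma bump_right x :
  c + s <= x <= c + s + l * s -> bump c s l x = c + l * s + (x - c - s) / l.
Proof.
  intro H; destruct (Rle_dec x (c + s)).
  - replace x with (c + s) by lra; rewrite bump_left by lra; field; lra.
  - unfold bump; destruct (Rle_dec x c); [lra|].
    destruct (Rle_dec x (c + s)); [lra|].
    destruct (Rle_dec x (c + s + l * s)); lra.
Qed.

Lemma bump_hi x : c + s + l * s <= x -> bump c s l x = x.
Proof.
  intro H; assert (0 < l * s) by nra.
  destruct (Rle_dec x (c + s + l * s)).
  - replace x with (c + s + l * s) by lra; rewrite bump_right by lra; field; lra.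
  - unfold bump; destruct (Rle_dec x c); [lra|].
    destruct (Rle_dec x (c + s)); [lra|].
    destruct (Rle_dec x (c + s + l * s)); lra.
Qed.

Lemma bump_cases x :
  (x <= c /\ bump c s l x = x) \/
  (c <= x <= c + s /\ bump c s l x = c + l * (x - c)) \/
  (c + s <= x <= c + s + l * s /\ bump c s l x = c + l * s + (x - c - s) / l) \/
  (c + s + l * s <= x /\ bump c s l x = x).
Proof.
  destruct (Rle_dec x c); [left; split; [|apply bump_lo]; lra|right].
  destruct (Rle_dec x (c + s)); [left; split; [|apply bump_left]; lra|right].
  destruct (Rle_dec x (c + s + l * s)); [left; split; [|apply bump_right]; lra|right].
  split; [|apply bump_hi]; lra.
Qed.

Lemma bump_lt x y : x < y -> bump c s l x < bump c s l y.
Proof.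
  assert (hls : 0 < l * s) by nra.
  assert (glue : forall m m', m <= m' ->
    (forall x y, x < y <= m -> bump c s l x < bump c s l y) ->
    (forall x y, m <= x < y -> y <= m' -> bump c s l x < bump c s l y) ->
    forall x y, x < y <= m' -> bump c s l x < bump c s l y).
  { intros m m' Hm H1 H2 a b Hab.
    destruct (Rle_dec b m); [apply H1; lra|].
    destruct (Rle_dec m a); [apply H2; lra|].
    apply Rlt_trans with (bump c s l m); [apply H1|apply H2]; lra. }
  intro Hxy; apply (glue (c + s + l * s) (Rmax y (c + s + l * s)));
    [apply Rmax_r| | |split; [exact Hxy|apply Rmax_l]].
  - apply (glue (c + s)); [lra|apply (glue c); [lra| |]|].
    + intros a b H; rewrite !bump_lo by lra; lra.
    + intros a b H H'; rewrite !bump_left by lra; nra.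
    + intros a b H H'; rewrite !bump_right by lra.
      apply Rplus_lt_compat_l, Rmult_lt_compat_r; [apply Rinv_0_lt_compat|]; lra.
  - intros a b H _; rewrite !bump_hi by lra; lra.
Qed.

End Bump.

Lemma bump_inv c s l x : 0 < s -> 0 < l -> bump c (l * s) (/ l) (bump c s l x) = x.
Proof.
  intros hs hl; assert (0 < l * s) by nra.
  assert (hl' : 0 < / l) by (apply Rinv_0_lt_compat; lra).
  assert (E : / l * (l * s) = s) by (field; lra).
  destruct (bump_cases c s l hs hl x) as [[K ->]|[[K ->]|[[K ->]|[K ->]]]].
  - apply bump_lo; auto.
  - rewrite bump_left; [field; lra|nra].
  - assert (D : x - c - s = (x - c - s) / l * l) by (field; lra).
    set (t := (x - c - s) / l) in *.
    rewrite bump_right; [unfold t; field; lra|nra..].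
  - apply bump_hi; lra.
Qed.

Lemma bump_inv' c s l x : 0 < s -> 0 < l -> bump c s l (bump c (l * s) (/ l) x) = x.
Proof.
  intros hs hl; assert (hl' : 0 < / l) by (apply Rinv_0_lt_compat; lra).
  assert (H := bump_inv c (l * s) (/ l) x).
  rewrite Rinv_inv in H; replace (/ l * (l * s)) with s in H by (field; lra).
  apply H; nra.
Qed.

(** The points that [B'] assigns to [B x - eps] and [B x + eps] bound a suitable neighbourhood of
    [x]. *)
Lemma increasing_continuous r (B B' : R -> R) :
  (forall x y, x < y -> B x < B y) -> (forall x, B (B' x) = x) ->
  cont_interval r B.
Proof.
  intros HB HB' x _ eps Heps.
  assert (HBI : forall x y, B x < B y -> x < y).
  { intros a b H; destruct (Rlt_le_dec a b) as [L|[L|L]]; auto; exfalso.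
    - apply HB in L; lra.
    - subst; lra. }
  assert (L1 : B' (B x - eps) < x) by (apply HBI; rewrite HB'; lra).
  assert (L2 : x < B' (B x + eps)) by (apply HBI; rewrite HB'; lra).
  exists (Rmin (x - B' (B x - eps)) (B' (B x + eps) - x)); split.
  - apply Rmin_glb_lt; lra.
  - intros y _ Hy; apply Rabs_def2 in Hy as [H1 H2].
    assert (M1 := Rmin_l (x - B' (B x - eps)) (B' (B x + eps) - x)).
    assert (M2 := Rmin_r (x - B' (B x - eps)) (B' (B x + eps) - x)).
    assert (K1 : B' (B x - eps) < y) by lra; apply HB in K1; rewrite HB' in K1.
    assert (K2 : y < B' (B x + eps)) by lra; apply HB in K2; rewrite HB' in K2.
    apply Rabs_def1; lra.
Qed.

Lemma bump_inF r Lam A c s l :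
  is_pos_mult_subgroup Lam -> is_add_subgroup A -> A r ->
  (forall k a, Lam k -> A a -> A (k * a)) ->
  A c -> A s -> Lam l -> 0 < c -> 0 < s -> c + s + l * s < r ->
  inF r Lam A (bump c s l).
Proof.
  intros (Lpos & L1 & _ & Linv) (A0 & Aadd & Aopp) Ar AL Ac As Ll hc hs hr.
  assert (hl := Lpos l Ll); assert (hls : 0 < l * s) by nra.
  assert (Inc := bump_lt c s l hs hl).
  assert (B0 : bump c s l 0 = 0) by (apply bump_lo; lra).
  assert (Br : bump c s l r = r) by (apply bump_hi; lra).
  assert (Out : forall B : R -> R, (forall x y, x < y -> B x < B y) ->
    B 0 = 0 -> B r = r -> forall x, 0 <= x < r -> 0 <= B x < r).
  { intros B HB E0 Er x [[H|<-] H']; apply HB in H'; [apply HB in H|]; lra. }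
  repeat split.
  - intros x Hx; destruct (Rlt_le_dec x 0); [apply bump_lo; lra|].
    apply bump_hi; auto; lra.
  - apply (Out _ Inc B0 Br); auto.
  - apply (Out _ Inc B0 Br); auto.
  - intros y Hy; exists (bump c (l * s) (/ l) y); split; [|apply bump_inv'; auto].
    assert (hl' : 0 < / l) by (apply Rinv_0_lt_compat; lra).
    apply (Out _ (bump_lt c (l * s) (/ l) hls hl')); auto.
    + apply bump_lo; lra.
    + apply bump_hi; auto; replace (/ l * (l * s)) with s by (field; lra); lra.
  - intros x y _ _ E; rewrite <- (bump_inv c s l x), E, bump_inv; auto.
  - exists 4%nat,
      (fun i => match i with O => 0 | 1%nat => c | 2%nat => c + s
                           | 3%nat => c + s + l * s | _ => r end),
      (fun i => match i with 1%nat => l | 2%nat => / l | _ => 1 end),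
      (fun i => match i with 1%nat => c - l * c | 2%nat => c + l * s - (c + s) / l
                           | _ => 0 end).
    assert (Als : A (l * s)) by auto.
    assert (Acs : A (c + s)) by auto.
    split; [reflexivity|split; [reflexivity|]].
    repeat split.
    + intros [|[|[|[|i]]]] Hi; lra || lia.
    + intros [|[|[|[|i]]]] Hi; auto.
    + intros [|[|[|[|i]]]] Hi; try lia.
      * rewrite B0; auto.
      * rewrite bump_lo by lra; auto.
      * rewrite bump_left by lra; replace (c + s - c) with s by lra; auto.
      * rewrite bump_hi by lra; auto.
    + intros [|[|[|[|i]]]] Hi; auto.
    + intros [|[|[|[|i]]]] x Hi Hx; try lia.
      * rewrite bump_lo by lra; lra.
      * rewrite bump_left by lra; lra.
      * rewrite bump_right by lra; field; lra.
      * rewrite bump_hi by lra; lra.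
  - apply (increasing_continuous r _ (bump c (l * s) (/ l)) Inc).
    intro x; apply bump_inv'; auto.
Qed.

(** * The centralizer of a bump *)

Lemma pow_small l a eps : 0 < l < 1 -> 0 < a -> 0 < eps -> exists n, l ^ n * a < eps.
Proof.
  intros Hl Ha He.
  destruct (pow_lt_1_zero l) with (y := eps / a) as [n Hn].
  - rewrite Rabs_right; lra.
  - apply Rdiv_lt_0_compat; lra.
  - exists n; specialize (Hn n (Nat.le_refl n)).
    assert (0 < l ^ n) by (apply pow_lt; lra).
    rewrite Rabs_right in Hn by lra.
    apply Rmult_lt_compat_r with (r := a) in Hn; [|lra].
    replace (eps / a * a) with eps in Hn by (field; lra); exact Hn.
Qed.

(** Outside [U] each application of [phi] multiplies the gap by [1 / l > 1], so it reaches [K] after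
    finitely many steps. *)
Lemma escape l (phi gap : R -> R) (D U : R -> Prop) K :
  0 < l < 1 -> 0 < K ->
  (forall t, D t -> 0 < gap t) ->
  (forall t, D t -> K <= gap t -> U t) ->
  (forall t, D t -> U t \/ (D (phi t) /\ l * gap (phi t) = gap t)) ->
  forall t, D t -> exists n, U (Nat.iter n phi t).
Proof.
  intros Hl HK Hgap HU Hphi.
  assert (W : forall n t, D t -> l ^ n * K <= gap t -> exists m, U (Nat.iter m phi t)).
  { induction n as [|n IH]; intros t Dt H.
    - exists O; apply HU; auto; simpl in *; lra.
    - destruct (Hphi t Dt) as [Ut|[Dt' E]]; [exists O; exact Ut|].
      destruct (IH (phi t) Dt') as [m Hm].
      + rewrite <- E in H; change (l ^ S n) with (l * l ^ n) in H.
        apply Rmult_le_reg_l with l; [lra|]. lra.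
      + exists (S m); rewrite Nat.iter_succ_r; exact Hm. }
  intros t Dt; destruct (pow_small l K (gap t)) as [n Hn]; auto.
  apply (W n); auto; lra.
Qed.

(** * Maps commuting with a linear contraction *)

Section Contraction.
Variables (phi h : R -> R) (z l mu beta : R) (U V : R -> Prop).
Hypothesis hl : 0 < l < 1.
Hypothesis HU : forall x, U x -> U (phi x) /\ phi x = z + l * (x - z).
Hypothesis HVU : forall x, V x -> U x.
Hypothesis HV : forall x, V x -> V (phi x) /\ h x = mu * x + beta.
Hypothesis Hcomm : forall x, h (phi x) = phi (h x).

Lemma iter_comm n x : h (Nat.iter n phi x) = Nat.iter n phi (h x).
Proof. induction n; simpl; [reflexivity|]; rewrite Hcomm, IHn; reflexivity. Qed.

Lemma iter_contraction n x :
  U x -> U (Nat.iter n phi x) /\ Nat.iter n phi x = z + l ^ n * (x - z).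
Proof.
  intro Ux; induction n as [|n [IHU IHE]]; simpl; [split; auto; lra|].
  destruct (HU _ IHU) as [HU' E]; split; auto; rewrite E, IHE; lra.
Qed.

(** Replacing [x] by an iterate [y] puts both [y] and [h y] where [phi] is linear; expanding
    [h (phi y) = phi (h y)] leaves [(1 - l) (mu z + beta - z) = 0]. *)
Lemma germ_fixes x n : V x -> U (Nat.iter n phi (h x)) -> mu * z + beta = z.
Proof.
  intros Vx Uy; rewrite <- iter_comm in Uy.
  assert (Vy : V (Nat.iter n phi x)) by (clear Uy; induction n; simpl; auto; apply HV; auto).
  set (y := Nat.iter n phi x) in *.
  destruct (HV y Vy) as [Vy' Ey], (HU _ Uy) as [_ E], (HV _ Vy') as [_ Ey'].
  destruct (HU y (HVU y Vy)) as [_ Ephi].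
  rewrite <- Hcomm, Ey', Ephi, Ey in E.
  assert (P : (1 - l) * (mu * z + beta - z) = 0) by lra.
  apply Rmult_integral in P; lra.
Qed.

Hypothesis Hfix : mu * z + beta = z.
Hypothesis Hreach : forall x, U x -> exists n, V (Nat.iter n phi x).

Lemma iter_image x : U x ->
  exists n, Nat.iter n phi (h x) = z + l ^ n * (mu * (x - z)).
Proof.
  intro Ux; destruct (Hreach x Ux) as [n Vn]; exists n.
  rewrite <- iter_comm; destruct (HV _ Vn) as [_ ->].
  destruct (iter_contraction n x Ux) as [_ ->].
  replace (mu * (z + l ^ n * (x - z)) + beta) with
    (mu * z + beta + l ^ n * (mu * (x - z))) by lra.
  rewrite Hfix; reflexivity.
Qed.

(** Iterating [phi] carries [x] into the germ domain [V], where [h] is known; the factor [l ^ n]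
    cancels afterwards. *)
Lemma contraction_linear x : U x -> U (h x) -> h x = z + mu * (x - z).
Proof.
  intros Ux Uhx; destruct (iter_image x Ux) as [n En].
  destruct (iter_contraction n _ Uhx) as [_ E]; rewrite E in En.
  assert (0 < l ^ n) by (apply pow_lt; lra).
  apply Rplus_eq_reg_l, Rmult_eq_reg_l in En; lra.
Qed.

(** Here the predicted value, not [h x], is known to lie in [U]: the two have equal images under
    [phi^n], and [phi] is injective. *)
Lemma contraction_linear' x :
  (forall a b, phi a = phi b -> a = b) ->
  U x -> U (z + mu * (x - z)) -> h x = z + mu * (x - z).
Proof.
  intros Hinj Ux Uy; destruct (iter_image x Ux) as [n En].
  destruct (iter_contraction n _ Uy) as [_ E].
  replace (z + mu * (x - z) - z) with (mu * (x - z)) in E by lra.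
  rewrite <- E in En; revert En; generalize (h x) (z + mu * (x - z)); clear -Hinj.
  induction n; simpl; auto.
Qed.

End Contraction.

Lemma piece_right (a : nat -> R) n x :
  a O <= x < a n -> exists i, (i < n)%nat /\ a i <= x < a (S i).
Proof.
  induction n as [|n IH]; intro H; [lra|].
  destruct (Rle_dec (a n) x) as [L|L]; [exists n; split; [lia|lra]|].
  destruct IH as [i [Hi Hx]]; [lra|]; exists i; split; [lia|auto].
Qed.

Lemma piece_left (a : nat -> R) n x :
  a O < x <= a n -> exists i, (i < n)%nat /\ a i < x <= a (S i).
Proof.
  induction n as [|n IH]; intro H; [lra|].
  destruct (Rlt_dec (a n) x) as [L|L]; [exists n; split; [lia|lra]|].
  destruct IH as [i [Hi Hx]]; [lra|]; exists i; split; [lia|auto].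
Qed.

Lemma germ_right r Lam A h c : pw_affine r Lam A h -> 0 <= c < r ->
  exists eps mu beta, 0 < eps /\ forall x, c < x < c + eps -> h x = mu * x + beta.
Proof.
  intros (n & a & lam & b & E0 & En & _ & _ & _ & _ & Hh) Hc.
  destruct (piece_right a n c) as [i [Hi Hx]]; [lra|].
  exists (a (S i) - c), (lam i), (b i); split; [lra|].
  intros x H; apply Hh; auto; lra.
Qed.

(** Pieces are closed on the left only, so the germ is read from the piece with
    [a i < d <= a (S i)]; this includes [d = r]. *)
Lemma germ_left r Lam A h d : pw_affine r Lam A h -> 0 < d <= r ->
  exists eps nu beta, 0 < eps /\ forall x, d - eps < x < d -> h x = nu * x + beta.
Proof.
  intros (n & a & lam & b & E0 & En & _ & _ & _ & _ & Hh) Hd.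
  destruct (piece_left a n d) as [i [Hi Hx]]; [lra|].
  exists (d - a i), (lam i), (b i); split; [lra|].
  intros x H; apply Hh; auto; lra.
Qed.

Section Centralizer.
Variables c s l : R.
Hypotheses (hs : 0 < s) (hl : 0 < l < 1).
Let d := c + s + l * s.
Let B := bump c s l.
Let B' := bump c (l * s) (/ l).

Lemma bump_moves x : c < x < d -> c < B x < x.
Proof.
  intro Hx; unfold B; split.
  - rewrite <- (bump_lo c s l c) at 1 by lra; apply bump_lt; lra.
  - unfold d in Hx; destruct (Rle_dec x (c + s)).
    + rewrite bump_left by lra; nra.
    + rewrite bump_right by lra.
      assert (D : x - c - s = (x - c - s) / l * l) by (field; lra).
      set (t := (x - c - s) / l) in *; nra.
Qed.

Lemma bump_fixes x : ~ (c < x < d) -> B x = x.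
Proof.
  intro H; unfold B, d in *; destruct (Rle_dec x c); [apply bump_lo; lra|].
  apply bump_hi; lra.
Qed.

Lemma bump'_left x : c <= x <= c + l * s -> B' x = c + (x - c) / l.
Proof. intro H; unfold B'; rewrite bump_left by nra; field; lra. Qed.

Lemma bump'_right x : c + l * s <= x <= d -> B' x = d + l * (x - d).
Proof.
  intro H; assert (0 < / l) by (apply Rinv_0_lt_compat; lra).
  assert (E : / l * (l * s) = s) by (field; lra).
  unfold B', d in *; rewrite bump_right; [field; lra|nra|lra|lra].
Qed.

Lemma bump_reaches_left x : c < x < d -> exists n, c < Nat.iter n B x <= c + s.
Proof.
  apply (escape l B (fun t => d - t) (fun t => c < t < d)
           (fun t => c < t <= c + s) (l * s)); auto.
  - nra.
  - intros; lra.
  - unfold d; intros; lra.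
  - intros t Ht; destruct (Rle_dec t (c + s)); [left; lra|right].
    assert (M := bump_moves t Ht); split; [lra|].
    unfold B, d in *; rewrite bump_right by lra; field; lra.
Qed.

Lemma bump'_reaches_right x : c < x < d -> exists n, c + l * s <= Nat.iter n B' x < d.
Proof.
  apply (escape l B' (fun t => t - c) (fun t => c < t < d)
           (fun t => c + l * s <= t < d) (l * s)); auto.
  - nra.
  - intros; lra.
  - intros; lra.
  - intros t Ht; destruct (Rle_dec (c + l * s) t); [left; lra|right].
    rewrite bump'_left by lra.
    assert (D : t - c = (t - c) / l * l) by (field; lra).
    set (y := (t - c) / l) in *; unfold d in *; split; [nra|lra].
Qed.

Variable h : R -> R.
Variables (r : R) (Lam A : R -> Prop).
Hypotheses (hc : 0 <= c) (hr : d <= r).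
Hypothesis Hpw : pw_affine r Lam A h.
Hypothesis Hinj : forall x y, h x = h y -> x = y.
Hypothesis Hcomm : forall x, h (B x) = B (h x).

(** The interval is the set of points moved by [B], and an injective map commuting with [B] sends no
    moved point to a fixed one. *)
Lemma commuting_preserves x : c < x < d -> c < h x < d.
Proof.
  intro Hx; destruct (classic (c < h x < d)) as [H|H]; auto; exfalso.
  apply bump_fixes in H; rewrite <- Hcomm in H; apply Hinj in H.
  apply bump_moves in Hx; lra.
Qed.

Lemma commuting_inverse x : h (B' x) = B' (h x).
Proof.
  rewrite <- (bump_inv' c s l x) at 2 by lra; fold B B'; rewrite Hcomm.
  symmetry; apply bump_inv; lra.
Qed.

(* Since [h] is affine near both ends of [(c, d)] and commutes with the
   contractions [B] at [c] and [B'] at [d], it is linear with slope [mu] on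
   [(c, c + s]] and with slope [nu] on much of [[c + l s, d)]; comparing the two
   on the overlap of these intervals gives [mu = nu = 1]. *)
Lemma commuting_rigid :
  c + l * s < h (c + s) <= c + s -> forall x, c < x < d -> h x = x.
Proof.
  intro Ht0; assert (hls : 0 < l * s < s) by nra.
  destruct (germ_right r Lam A h c Hpw) as (e1 & mu & b1 & He1 & G1); [unfold d in hr; lra|].
  destruct (germ_left r Lam A h d Hpw) as (e2 & nu & b2 & He2 & G2); [unfold d in *; lra|].
  set (U1 := fun x => c < x <= c + s).
  set (V1 := fun x => c < x < c + Rmin e1 s).
  set (U2 := fun x => c + l * s <= x < d).
  set (V2 := fun x => d - Rmin e2 s < x < d).
  assert (M1 : 0 < Rmin e1 s <= e1 /\ Rmin e1 s <= s)
    by (repeat split; [apply Rmin_glb_lt|apply Rmin_l|apply Rmin_r]; lra).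
  assert (M2 : 0 < Rmin e2 s <= e2 /\ Rmin e2 s <= s)
    by (repeat split; [apply Rmin_glb_lt|apply Rmin_l|apply Rmin_r]; lra).
  assert (HU1 : forall x, U1 x -> U1 (B x) /\ B x = c + l * (x - c)).
  { unfold U1, B; intros x Hx; rewrite bump_left by lra; split; [nra|lra]. }
  assert (HVU1 : forall x, V1 x -> U1 x) by (unfold U1, V1; intros; lra).
  assert (HV1 : forall x, V1 x -> V1 (B x) /\ h x = mu * x + b1).
  { intros x Vx; destruct (HU1 x (HVU1 x Vx)) as [_ ->]; unfold V1 in *.
    split; [nra|apply G1; lra]. }
  assert (HU2 : forall x, U2 x -> U2 (B' x) /\ B' x = d + l * (x - d)).
  { unfold U2; intros x Hx; rewrite bump'_right by lra; split; [nra|lra]. }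
  assert (HVU2 : forall x, V2 x -> U2 x) by (unfold U2, V2, d; intros; lra).
  assert (HV2 : forall x, V2 x -> V2 (B' x) /\ h x = nu * x + b2).
  { intros x Vx; destruct (HU2 x (HVU2 x Vx)) as [_ ->]; unfold V2 in *.
    split; [nra|apply G2; lra]. }
  assert (R1 : forall x, U1 x -> exists n, V1 (Nat.iter n B x)).
  { intros x Ux; destruct (pow_small l (x - c) (Rmin e1 s)) as [n Hn];
      [lra|unfold U1 in Ux; lra|lra|].
    exists n; destruct (iter_contraction B c l U1 HU1 n x Ux) as [HUn En].
    unfold U1, V1 in *; rewrite En in *; lra. }
  assert (R2 : forall x, U2 x -> exists n, V2 (Nat.iter n B' x)).
  { intros x Ux; destruct (pow_small l (d - x) (Rmin e2 s)) as [n Hn];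
      [lra|unfold U2 in Ux; lra|lra|].
    exists n; destruct (iter_contraction B' d l U2 HU2 n x Ux) as [HUn En].
    unfold U2, V2 in *; rewrite En in *; lra. }
  (* Without continuity a point near [c] may be sent anywhere in [(c, d)]; iterating [B] brings its
     image into [U1], as [germ_fixes] requires. *)
  assert (F1 : mu * c + b1 = c).
  { destruct (bump_reaches_left (h (c + Rmin e1 s / 2))) as [n Hn].
    - apply commuting_preserves; unfold d; lra.
    - apply (germ_fixes B h c l mu b1 U1 V1 hl HU1 HVU1 HV1 Hcomm
               (c + Rmin e1 s / 2) n); auto; unfold V1; lra. }
  assert (F2 : nu * d + b2 = d).
  { destruct (bump'_reaches_right (h (d - Rmin e2 s / 2))) as [n Hn].
    - apply commuting_preserves; unfold d; lra.
    - apply (germ_fixes B' h d l nu b2 U2 V2 hl HU2 HVU2 HV2 commuting_inverse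
               (d - Rmin e2 s / 2) n); auto; unfold V2; lra. }
  assert (BI : forall x y, B x = B y -> x = y).
  { intros x y E; rewrite <- (bump_inv c s l x) by lra; fold B; rewrite E.
    apply bump_inv; lra. }
  assert (BI' : forall x y, B' x = B' y -> x = y).
  { intros x y E; rewrite <- (bump_inv' c s l x) by lra; fold B'; rewrite E.
    apply bump_inv'; lra. }
  assert (L1 := contraction_linear' B h c l mu b1 U1 V1 HU1 HV1 Hcomm F1 R1).
  assert (L2 := contraction_linear' B' h d l nu b2 U2 V2 HU2 HV2 commuting_inverse F2 R2).
  assert (Es : h (c + s) = c + mu * s).
  { rewrite (contraction_linear B h c l mu b1 U1 V1 hl HU1 HV1 Hcomm F1 R1 (c + s));
      unfold U1; lra. }
  assert (Hmu : l < mu <= 1) by (rewrite Es in Ht0; split; nra).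
  (* [x2] is the preimage of [c + l s], the left end of [U2], by the formula at [c]. The formula at
     [d] yields the preimage [d - s / nu], which equals [x2] as soon as it lies in [U2]. *)
  set (x2 := c + l * s / mu).
  assert (D2 : l * s / mu * mu = l * s) by (field; lra).
  assert (P2 : l * s <= l * s / mu < s) by (split; nra).
  assert (E2 : h x2 = c + l * s).
  { unfold x2; rewrite L1; auto; unfold U1; lra. }
  assert (Hpre : forall x, U2 x -> nu * (d - x) = s -> x = x2).
  { intros x Ux E; apply Hinj; rewrite E2, L2; auto; unfold U2, d in *; lra. }
  assert (Hnu : 0 < nu).
  { destruct (Rlt_le_dec 0 nu) as [H|H]; auto; exfalso.
    assert (W := commuting_preserves (d - Rmin e2 s / 2)).
    rewrite (proj2 (HV2 (d - Rmin e2 s / 2) ltac:(unfold V2; lra))) in W.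
    unfold d in *; nra. }
  assert (Dn : s / nu * nu = s) by (field; lra).
  (* Otherwise [d - s / nu] lies to the right of [d - l s = c + s], whereas [x2] is to the left. The
     bound says that the formula at [d] predicts a value in [U2] at [c + s], so it applies there. *)
  assert (Hns : l * s <= s / nu).
  { destruct (Rle_lt_dec (l * s) (s / nu)) as [H|H]; auto; exfalso.
    assert (E := Hpre (d - s / nu)); unfold x2, U2, d in E.
    assert (0 < s / nu) by (apply Rdiv_lt_0_compat; lra).
    lra. }
  assert (E1 : mu = 1 + l - nu * l).
  { assert (E : h (c + s) = d + nu * (c + s - d)).
    { apply L2; auto; unfold U2, d; [lra|]; split; nra. }
    rewrite Es in E; unfold d in E; nra. }
  assert (N1 : 1 <= nu) by nra.
  assert (E3 : s / nu = s + l * s - l * s / mu).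
  { assert (E := Hpre (d - s / nu)); unfold x2, U2, d in E.
    assert (0 < s / nu <= s) by (split; nra).
    lra. }
  (* Multiplying [E3] by [nu mu] gives [mu + l nu = (1 + l) nu mu], and the left side is [1 + l] by
     [E1]. *)
  assert (E4 : nu * mu = 1).
  { assert (E : s / nu * nu * mu = (s + l * s) * nu * mu - l * s / mu * mu * nu)
      by (rewrite E3; ring).
    rewrite Dn, D2 in E.
    assert (P : s * ((1 + l) * (nu * mu - 1)) = 0) by (rewrite E1 in *; nra).
    apply Rmult_integral in P as [P|P]; [lra|].
    apply Rmult_integral in P; lra. }
  (* Eliminating [nu] leaves a quadratic with roots 1 and [l]. The root [l] is the slope of [B]
     itself and is excluded because [h (c + s)] lies strictly to the right of [c + l s]. *)
  assert (E5 : mu = 1).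
  { assert (P : (mu - 1) * (mu - l) = 0) by nra.
    apply Rmult_integral in P; lra. }
  assert (E6 : nu = 1) by (rewrite E5 in E4; lra).
  intros x Hx; destruct (Rle_dec x (c + s)).
  - rewrite (L1 x); auto; [rewrite E5; lra|unfold U1; lra|rewrite E5; unfold U1; lra].
  - rewrite (L2 x); auto;
      [rewrite E6; lra|unfold U2, d in *; lra|rewrite E6; unfold U2, d in *; lra].
Qed.

End Centralizer.

(** * Supports in a group of transformations *)

Section Supports.
Variables (r : R) (G : (R -> R) -> Prop) (HG : is_subgroup_V r G).
Let M := G_struct r G HG.

Definition gfun (x : Gelt G) : R -> R := fst (proj1_sig x).
Definition ginv (x : Gelt G) : R -> R := snd (proj1_sig x).

Lemma gfunK (x : Gelt G) t : ginv x (gfun x t) = t.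
Proof. destruct x as [[f f'] (Hf & H1 & H2)]; apply H1. Qed.

Lemma ginvK (x : Gelt G) t : gfun x (ginv x t) = t.
Proof. destruct x as [[f f'] (Hf & H1 & H2)]; apply H2. Qed.

Lemma gfun_inj (x : Gelt G) t t' : gfun x t = gfun x t' -> t = t'.
Proof. intro H; rewrite <- (gfunK x t), H; apply gfunK. Qed.

Lemma gfun_mul (x y : carrier M) t : gfun (s_mul M x y) t = gfun y (gfun x t).
Proof.
  destruct x as [[f f'] (Hf & H1 & H2)], y as [[g g'] (Hg & K1 & K2)]; reflexivity.
Qed.

Lemma gfun_inv (x : carrier M) t : gfun (s_inv M x) t = ginv x t.
Proof. destruct x as [[f f'] (Hf & H1 & H2)]; reflexivity. Qed.

Lemma Gelt_eq (x y : Gelt G) : (forall t, gfun x t = gfun y t) -> x = y.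
Proof.
  intro H; assert (H' : forall t, ginv x t = ginv y t)
    by (intro t; apply (gfun_inj x); rewrite ginvK, H, ginvK; reflexivity).
  destruct x as [[f f'] Hx], y as [[g g'] Hy]; unfold gfun, ginv in *; simpl in *.
  apply functional_extensionality in H, H'; subst.
  f_equal; apply proof_irrelevance.
Qed.

Lemma G_struct_group : is_group M.
Proof.
  split; intros; apply Gelt_eq; intro t; rewrite ?gfun_mul, ?gfun_inv; try reflexivity.
  - apply ginvK.
  - apply gfunK.
Qed.

Lemma commutes_iff (x y : carrier M) :
  commutes x y <-> forall t, gfun y (gfun x t) = gfun x (gfun y t).
Proof.
  split.
  - intros H t; rewrite <- !gfun_mul, H; reflexivity.
  - intro H; apply Gelt_eq; intro t; rewrite !gfun_mul; apply H.
Qed.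

Lemma gfun_conj (q x : carrier M) t : gfun (conj_by q x) t = gfun x (gfun q (ginv x t)).
Proof. unfold conj_by; rewrite !gfun_mul, gfun_inv; reflexivity. Qed.

Definition strict_inc (B : R -> R) : Prop := forall x y, x < y -> B x < B y.

Definition supported (a b : R) (q : Gelt G) : Prop :=
  forall t, ~ (a < t < b) -> gfun q t = t.

Definition moves (a b : R) (q : Gelt G) : Prop :=
  forall t, a < t < b -> gfun q t <> t.

Lemma strict_inc_ginv (x : Gelt G) : strict_inc (gfun x) -> strict_inc (ginv x).
Proof.
  intros H t t' L; destruct (Rlt_le_dec (ginv x t) (ginv x t')) as [K|[K|K]]; auto; exfalso.
  - apply H in K; rewrite !ginvK in K; lra.
  - assert (E : t = t') by (rewrite <- (ginvK x t), <- K; apply ginvK); lra.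
Qed.

Lemma strict_inc_between (x : Gelt G) a b t : strict_inc (gfun x) ->
  (gfun x a < t < gfun x b <-> a < ginv x t < b).
Proof.
  intro H; split; intros [H1 H2].
  - apply (strict_inc_ginv x H) in H1, H2; rewrite gfunK in H1, H2; auto.
  - apply H in H1, H2; rewrite ginvK in H1, H2; auto.
Qed.

Lemma supported_conj (x q : carrier M) a b : strict_inc (gfun x) ->
  supported a b q -> supported (gfun x a) (gfun x b) (conj_by q x).
Proof.
  intros H Hq t Ht; rewrite strict_inc_between in Ht by auto.
  rewrite gfun_conj, Hq by auto; apply ginvK.
Qed.

Lemma moves_conj (x q : carrier M) a b : strict_inc (gfun x) ->
  moves a b q -> moves (gfun x a) (gfun x b) (conj_by q x).
Proof.
  intros H Hq t Ht E; rewrite strict_inc_between in Ht by auto.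
  apply (Hq _ Ht), (gfun_inj x); rewrite <- gfun_conj, E; symmetry; apply ginvK.
Qed.

Lemma supported_sub a b a' b' q : a' <= a -> b <= b' ->
  supported a b q -> supported a' b' q.
Proof. intros Ha Hb H t Ht; apply H; lra. Qed.

Lemma supported_stable a b q t : supported a b q -> a < t < b -> a < gfun q t < b.
Proof.
  intros H Ht; destruct (classic (a < gfun q t < b)) as [K|K]; auto; exfalso.
  assert (E := gfun_inj _ _ _ (H _ K)); rewrite E in K; auto.
Qed.

Lemma supported_commutes a b a' b' (q q' : carrier M) :
  supported a b q -> supported a' b' q' -> b <= a' -> commutes q q'.
Proof.
  intros H H' L; apply commutes_iff; intro t.
  destruct (classic (a < t < b)) as [K|K].
  - assert (K' := supported_stable _ _ _ _ H K).
    rewrite (H' t), (H' (gfun q t)) by lra; reflexivity.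
  - rewrite (H t K); destruct (classic (a' < t < b')) as [K'|K'].
    + assert (K2 := supported_stable _ _ _ _ H' K').
      symmetry; apply H; lra.
    + rewrite (H' t K'); symmetry; auto.
Qed.

Lemma strict_inc_iter B n : strict_inc B -> strict_inc (Nat.iter n B).
Proof. intro H; induction n; intros x y L; simpl; auto. Qed.

Lemma supported_iter_conj (x q : carrier M) a b n : strict_inc (gfun x) ->
  supported a b q ->
  supported (Nat.iter n (gfun x) a) (Nat.iter n (gfun x) b) (iter_conj x n q).
Proof. intros H Hq; induction n; simpl; auto; apply supported_conj; auto. Qed.

Lemma moves_iter_conj (x q : carrier M) a b n : strict_inc (gfun x) ->
  moves a b q ->
  moves (Nat.iter n (gfun x) a) (Nat.iter n (gfun x) b) (iter_conj x n q).
Proof. intros H Hq; induction n; simpl; auto; apply moves_conj; auto. Qed.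

Lemma supported_iter_conj_inv (x q : carrier M) a b n : strict_inc (gfun x) ->
  supported a b (iter_conj x n q) ->
  supported (Nat.iter n (ginv x) a) (Nat.iter n (ginv x) b) q.
Proof.
  intro H; revert a b; induction n as [|n IH]; intros a b Hq; auto.
  rewrite !Nat.iter_succ_r; apply IH; clear IH; intros t Ht.
  apply (gfun_inj x).
  assert (K : ~ (a < gfun x t < b)).
  { intros [K1 K2]; apply Ht; split.
    - apply (strict_inc_ginv x H) in K1; rewrite gfunK in K1; auto.
    - apply (strict_inc_ginv x H) in K2; rewrite gfunK in K2; auto. }
  apply Hq in K; change (iter_conj x (S n) q) with (conj_by (iter_conj x n q) x) in K.
  rewrite gfun_conj, gfunK in K; exact K.
Qed.

(** Continuity of [x] plays no part outside the interval: as a bijection, [x] also preserves the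
    complement, where [q] is trivial. *)
Lemma conj_supported_fixed (x q : carrier M) a b :
  (forall t, a < t < b -> gfun x t = t) -> supported a b q -> conj_by q x = q.
Proof.
  intros H Hq; apply Gelt_eq; intro t; rewrite gfun_conj.
  destruct (classic (a < t < b)) as [K|K].
  - assert (E : ginv x t = t) by (rewrite <- (H t K) at 1; apply gfunK).
    rewrite E; apply H, (supported_stable a b); auto.
  - assert (K' : ~ (a < ginv x t < b)).
    { intro K'; apply K; rewrite <- (ginvK x t), (H _ K'); exact K'. }
    rewrite (Hq _ K'), (Hq _ K); apply ginvK.
Qed.

Lemma power_exists (x : carrier M) n : exists y : carrier M,
  commutes y x /\ (forall t, gfun y t = Nat.iter n (gfun x) t) /\
  forall q, conj_by q y = iter_conj x n q.
Proof.
  assert (HM := G_struct_group).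
  induction n as [|n (y & Cy & Hy & Qy)].
  - exists (s_one M); split; [apply commutes_one_l, HM|split; [reflexivity|]].
    apply conj_by_one, HM.
  - exists (s_mul M y x); split; [|split].
    + apply (commutes_mul_l M HM); [exact Cy|reflexivity].
    + intro t; rewrite gfun_mul, Hy; reflexivity.
    + intro q; rewrite <- (conj_by_conj M HM), Qy; reflexivity.
Qed.

Lemma bump_element Lam A c s l : is_pos_mult_subgroup Lam -> is_add_subgroup A -> A r ->
  (forall k a, Lam k -> A a -> A (k * a)) ->
  (forall f, inF r Lam A f -> G f) ->
  A c -> A s -> Lam l -> 0 < c -> 0 < s -> c + s + l * s < r ->
  exists x : Gelt G, gfun x = bump c s l /\ ginv x = bump c (l * s) (/ l).
Proof.
  intros HL HA Ar AL HF Ac As Ll hc hs hr; assert (hl := proj1 HL l Ll).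
  unshelve eexists (exist _ (bump c s l, bump c (l * s) (/ l)) _); [|split; reflexivity].
  split; [|split; intro t; [apply bump_inv|apply bump_inv']]; auto.
  apply HF, bump_inF; auto.
Qed.

Section Bump_centralizer.
Variables c s l : R.
Hypotheses (hs : 0 < s) (hl : 0 < l < 1) (hc : 0 <= c).
Let d := c + s + l * s.
Hypothesis hr : d <= r.
Variable F : carrier M.
Hypotheses (HF : gfun F = bump c s l) (HF' : ginv F = bump c (l * s) (/ l)).

(** An orbit point is pushed towards the far end until it crosses the domain. Since [c + s] is
    mapped to [c + l s], one step cannot jump over the domain. *)
Lemma fundamental_domain x : c < x < d -> exists n,
  c + l * s < Nat.iter n (gfun F) x <= c + s \/
  c + l * s < Nat.iter n (ginv F) x <= c + s.
Proof.
  intro Hx; assert (hls : 0 < l * s < s) by nra.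
  assert (Et : gfun F (c + s) = c + l * s) by (rewrite HF, bump_left by lra; lra).
  assert (Inc : strict_inc (gfun F))
    by (intros a b L; rewrite HF; apply bump_lt; lra).
  destruct (Rle_lt_dec x (c + s)) as [L|L].
  - destruct (bump'_reaches_right c s l hs hl x Hx) as [n Hn]; rewrite <- HF' in Hn.
    revert x Hx L Hn; induction n as [|n IH]; intros x Hx L Hn.
    (* The point [c + l s] is missing from the half-open domain, but its preimage [c + s] belongs to
       it. *)
    + simpl in Hn; destruct Hn as [[Hn|Hn] _]; [exists O; right; simpl; lra|].
      exists 1%nat; right; simpl.
      rewrite <- Hn, <- Et, gfunK; lra.
    + destruct (Rlt_le_dec (c + l * s) x) as [K|K]; [exists O; left; simpl; lra|].
      assert (Hx' : ginv F x <= c + s).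
      { destruct (Rle_lt_dec (ginv F x) (c + s)) as [Q|Q]; auto; exfalso.
        apply Inc in Q; rewrite ginvK in Q; lra. }
      assert (Gx : c < ginv F x).
      { destruct (Rlt_le_dec c (ginv F x)) as [Q|Q]; auto; exfalso.
        assert (E : gfun F (ginv F x) = ginv F x) by (rewrite HF; apply bump_lo; auto).
        rewrite ginvK in E; lra. }
      destruct (IH (ginv F x)) as [m [Hm|Hm]]; auto.
      * unfold d; lra.
      * rewrite <- Nat.iter_succ_r; exact Hn.
      * destruct m as [|m].
        -- exists 1%nat; right; exact Hm.
        -- exists m; left; rewrite Nat.iter_succ_r, ginvK in Hm; exact Hm.
      * exists (S m); right; rewrite Nat.iter_succ_r; exact Hm.
  - destruct (bump_reaches_left c s l hs hl x Hx) as [n Hn]; rewrite <- HF in Hn.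
    revert x Hx L Hn; induction n as [|n IH]; intros x Hx L Hn; [simpl in Hn; lra|].
    rewrite Nat.iter_succ_r in Hn.
    assert (K : c + l * s < gfun F x) by (rewrite <- Et; apply Inc; lra).
    destruct (Rle_lt_dec (gfun F x) (c + s)) as [Q|Q];
      [exists 1%nat; left; simpl; lra|].
    destruct (IH (gfun F x)) as [m [Hm|Hm]]; auto.
    + assert (W := bump_moves c s l hs hl x Hx); rewrite HF; unfold d in *; lra.
    + exists (S m); left; rewrite Nat.iter_succ_r; exact Hm.
    + destruct m as [|m]; [simpl in Hm; lra|].
      exists m; right; rewrite Nat.iter_succ_r, gfunK in Hm; exact Hm.
Qed.

Lemma pw_affine_Gelt (x : Gelt G) : pw_affine r posR allR (gfun x).
Proof. apply (proj1 HG); exact (proj1 (proj2_sig x)). Qed.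

Lemma centralizer_rigid (x : carrier M) : commutes x F ->
  c + l * s < gfun x (c + s) <= c + s -> forall t, c < t < d -> gfun x t = t.
Proof.
  intros Cx Hx; apply (commuting_rigid c s l hs hl (gfun x) r posR allR); auto.
  - apply pw_affine_Gelt.
  - apply gfun_inj.
  - intro t; rewrite <- HF; symmetry; apply commutes_iff; exact Cx.
Qed.

(** Some power of [F] or of its inverse brings the image of [c + s] under [x] back into the
    fundamental domain. The product of [x] with that power still centralizes [F], hence is the
    identity on [(c, d)] by rigidity. *)
Lemma bump_centralizer (x : carrier M) : commutes x F -> exists n,
  (forall q : carrier M, supported c d q -> conj_by q x = iter_conj F n q) \/
  (forall q : carrier M, supported c d q -> iter_conj F n (conj_by q x) = q).
Proof.
  intro Cx; assert (HM := G_struct_group).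
  assert (hls : 0 < l * s < s) by nra.
  destruct (fundamental_domain (gfun x (c + s))) as [n Hn].
  { apply (commuting_preserves c s l hs hl).
    - apply gfun_inj.
    - intro t; rewrite <- HF; symmetry; apply commutes_iff; exact Cx.
    - lra. }
  destruct (power_exists F n) as (y & Cy & Hy & Qy); exists n.
  destruct Hn as [Hn|Hn]; [right|left]; intros q Hq.
  - rewrite <- Qy, (conj_by_conj M HM); apply conj_supported_fixed with c d; auto.
    apply centralizer_rigid.
    + apply (commutes_mul_l M HM); auto.
    + rewrite gfun_mul, Hy; exact Hn.
  - assert (Hy' : forall t, ginv y t = Nat.iter n (ginv F) t).
    { intro t; apply (gfun_inj y); rewrite ginvK, Hy; revert t; clear.
      induction n as [|n IH]; intro t; [reflexivity|].
      rewrite Nat.iter_succ_r; simpl; rewrite ginvK; apply IH. }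
    rewrite <- Qy, <- (mulgVK M HM x y) at 1.
    rewrite <- (conj_by_conj M HM); f_equal.
    apply conj_supported_fixed with c d; auto; apply centralizer_rigid.
    + apply (commutes_mul_l M HM); auto.
      apply commutes_iff; intro t; rewrite !gfun_inv; apply (gfun_inj y).
      rewrite ginvK; assert (E := proj1 (commutes_iff y F) Cy (ginv y t)).
      rewrite ginvK in E; symmetry; exact E.
    + rewrite gfun_mul, gfun_inv, Hy'; exact Hn.
Qed.

End Bump_centralizer.
End Supports.

(** * The interpretation *)

Lemma small_slope Lam eps : is_pos_mult_subgroup Lam -> (exists l, Lam l /\ l <> 1) ->
  0 < eps -> exists l, Lam l /\ 0 < l < eps.
Proof.
  intros (Lpos & L1 & Lmul & Linv) [k [Lk Nk]] He.
  assert (H : exists l, Lam l /\ 0 < l < 1).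
  { assert (P := Lpos k Lk); destruct (Rlt_le_dec k 1); [exists k; auto|].
    exists (/ k); split; [auto|split; [apply Rinv_0_lt_compat; auto|]].
    rewrite <- Rinv_1; apply Rinv_lt_contravar; lra. }
  destruct H as [l [Ll Hl]], (pow_small l 1 eps Hl Rlt_0_1 He) as [n Hn].
  exists (l ^ n); split; [|assert (0 < l ^ n) by (apply pow_lt; lra); lra].
  clear Hn; induction n; simpl; auto.
Qed.

Section Bump_arithmetic.
Variables (r : R) (G : (R -> R) -> Prop) (HG : is_subgroup_V r G).
Let M := G_struct r G HG.
Variables s l : R.
Hypotheses (hs : 0 < s) (hl : 0 < l < / 4).
Let c := s + l * s.
Let d := c + s + l * s.
Hypothesis hr : d <= r.
Variables F U W1 W2 : carrier M.
Hypotheses (HF : gfun G F = bump c s l) (HF' : ginv G F = bump c (l * s) (/ l)).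
Hypothesis HU : gfun G U = bump c (l * s) l.
Hypotheses (HW1 : gfun G W1 = bump (s - l * s) (l * s) (/ l))
  (HW2 : gfun G W2 = bump (2 * s) s l).

(* [W] contracts by the factor [l] towards [2 s] near that point, mapping [(c, d)]
   onto [(a, b)]; and [e], the right end of the support of [U], satisfies
   [F b <= e <= a]. *)
Let W : carrier M := s_mul M W1 W2.
Let a := 2 * s - l * s + l * (l * s).
Let b := 2 * s + 2 * (l * (l * s)).
Let e := c + l * s + l * (l * s).

(** With these products as atoms, all comparisons of positions below become linear. *)
Lemma bump_sizes : 0 < l * s < s / 4 /\ 0 < l * (l * s) < l * s / 4 /\
  0 < l * (l * (l * s)) < l * (l * s) / 4.
Proof.
  assert (H : forall x, 0 < x -> 0 < l * x < x / 4) by (intros; nra).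
  assert (H1 := H s hs); assert (H2 := H (l * s)); assert (H3 := H (l * (l * s))).
  lra.
Qed.

(** [W1] has slope [l] on [[s, 2 s]] and pushes points right towards [2 s]; [W2] has slope [l] on
    [[2 s, 3 s]] and pushes them left towards [2 s]. Since [s < c] and [d < 3 s], both ends move
    inwards. *)
Lemma W_endpoints : gfun G W c = a /\ gfun G W d = b.
Proof.
  destruct bump_sizes as (S1 & S2 & S3).
  assert (hl' : 0 < / l) by (apply Rinv_0_lt_compat; lra).
  assert (E : / l * (l * s) = s) by (field; lra).
  unfold W, M; rewrite !gfun_mul, HW1, HW2; unfold a, b, d, c; split.
  - assert (Ec : bump (s - l * s) (l * s) (/ l) (s + l * s) = 2 * s - l * s + l * (l * s)).
    { rewrite bump_right; [rewrite E; field|..]; lra. }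
    rewrite Ec, bump_lo; lra.
  - assert (Ed : bump (s - l * s) (l * s) (/ l) (s + l * s + s + l * s) =
                 s + l * s + s + l * s) by (apply bump_hi; lra).
    rewrite Ed, bump_left; lra.
Qed.

Lemma strict_inc_F : strict_inc (gfun G F).
Proof. intros x y L; rewrite HF; apply bump_lt; lra. Qed.

Lemma strict_inc_W : strict_inc (gfun G W).
Proof.
  destruct bump_sizes as (S1 & _).
  intros x y L; unfold W, M; rewrite !gfun_mul, HW1, HW2; apply bump_lt; [lra..|].
  apply bump_lt; [lra|apply Rinv_0_lt_compat|]; lra.
Qed.

Lemma F_le x : gfun G F x <= x.
Proof.
  rewrite HF; destruct (classic (c < x < c + s + l * s)) as [H|H].
  - apply (bump_moves c s l) in H; lra.
  - rewrite (bump_fixes c s l) by (auto; lra); lra.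
Qed.

(** As [b <= c + s], one application of [F] sends [b] to [c + l (b - c)], which is at most [e];
    further applications only move left. *)
Lemma iter_F_bounds n : (0 < n)%nat ->
  c < Nat.iter n (gfun G F) a /\ Nat.iter n (gfun G F) b <= e.
Proof.
  destruct bump_sizes as (S1 & S2 & S3); intro Hn; split.
  - clear Hn; assert (K : forall t, c < t -> c < gfun G F t).
    { intros t Ht; rewrite HF; rewrite <- (bump_lo c s l c) at 1 by lra.
      apply bump_lt; lra. }
    induction n; simpl; auto; unfold a, c; lra.
  - induction Hn as [|n Hn IH]; simpl.
    + rewrite HF; unfold b, e, c; rewrite bump_left; lra.
    + apply Rle_trans with (2 := IH), F_le.
Qed.

Lemma iter_F_inv n x : x <= Nat.iter n (ginv G F) x.
Proof.
  induction n; simpl; [lra|].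
  apply Rle_trans with (1 := IHn).
  assert (H := F_le (ginv G F (Nat.iter n (ginv G F) x))).
  rewrite ginvK in H; exact H.
Qed.

Lemma supported_U : supported G c e U.
Proof.
  destruct bump_sizes as (S1 & S2 & S3).
  intros t Ht; rewrite HU; apply bump_fixes; auto; lra.
Qed.

(** Positive translates of [(a, b)] by [F] lie inside [(c, e)], all of whose points [U] moves to the
    left; the other translates lie to the right of [e], where [U] is trivial. *)
Lemma bump_arithmetic_data : arithmetic_data M F W U (supported G c d).
Proof.
  destruct bump_sizes as (S1 & S2 & S3), W_endpoints as [Wc Wd].
  assert (Fs : supported G c d F) by (intros t Ht; rewrite HF; apply bump_fixes; auto; lra).
  assert (Hw : forall q : carrier M, supported G c d q -> supported G a b (conj_by q W)).
  { intros q Hq; rewrite <- Wc, <- Wd; apply supported_conj; auto using strict_inc_W. }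
  assert (ea : e <= a) by (unfold e, a, c; lra).
  constructor.
  - exact Fs.
  - intros q Hq.
    rewrite <- (Fs c), <- (Fs d) by lra; apply supported_conj; auto using strict_inc_F.
  - intros q Hq; apply (supported_sub G a b); auto; unfold a, b, d, c; lra.
  - intros x Cx; apply (bump_centralizer r G HG c s l); auto; unfold c; lra.
  - intros n q q' Hn Hq Hq'; destruct (iter_F_bounds n Hn) as [_ Hb].
    apply (supported_commutes r G HG _ _ _ _ _ _
             (supported_iter_conj r G HG F _ a b n strict_inc_F (Hw q Hq)) (Hw q' Hq')).
    lra.
  - intros n Hn C; destruct (iter_F_bounds n Hn) as [Ha Hb].
    set (q := iter_conj F n (conj_by F W)) in *.
    assert (Qs : supported G (Nat.iter n (gfun G F) a) (Nat.iter n (gfun G F) b) q)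
      by (apply supported_iter_conj; auto using strict_inc_F).
    assert (Qm : moves G (Nat.iter n (gfun G F) a) (Nat.iter n (gfun G F) b) q).
    { apply moves_iter_conj; [apply strict_inc_F|].
      rewrite <- Wc, <- Wd; apply moves_conj; [apply strict_inc_W|].
      intros t Ht; rewrite HF; apply (bump_moves c s l) in Ht; lra. }
    assert (Lab : Nat.iter n (gfun G F) a < Nat.iter n (gfun G F) b)
      by (apply (strict_inc_iter _ n strict_inc_F); unfold a, b; lra).
    set (x := Nat.iter n (gfun G F) a) in *; set (y := Nat.iter n (gfun G F) b) in *.
    assert (Ux : x < ginv G U x).
    { destruct (Rlt_le_dec x (ginv G U x)) as [H|H]; auto; exfalso.
      assert (Mx : gfun G U x < x)
        by (rewrite HU; apply (bump_moves c (l * s) l); unfold e in *; lra).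
      assert (Inc : strict_inc (gfun G U)) by (intros ? ? ?; rewrite HU; apply bump_lt; lra).
      destruct H as [H|H]; [apply Inc in H|rewrite <- H in Mx at 1]; rewrite ginvK in *; lra. }
    (* [U] moves a point [t] of the support of [q] out of it *)
    set (t := (x + Rmin y (ginv G U x)) / 2).
    assert (M1 := Rmin_l y (ginv G U x)); assert (M2 := Rmin_r y (ginv G U x)).
    assert (M3 : x < Rmin y (ginv G U x)) by (apply Rmin_glb_lt; auto).
    assert (Ht : x < t < y) by (unfold t; lra).
    assert (Ut : gfun G U t < x).
    { rewrite <- (ginvK G U x), HU; apply bump_lt; unfold t; lra. }
    (* If [q] commuted with [U], then, since it fixes the point [U t] outside its support, it would
       fix [t] too. *)
    apply (Qm t Ht), (gfun_inj G U).
    rewrite (proj1 (commutes_iff r G HG q U) C t); apply Qs; lra.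
  - intros n q Hq.
    assert (Qs : supported G (Nat.iter n (ginv G F) a) (Nat.iter n (ginv G F) b) q).
    { apply (supported_iter_conj_inv r G HG); [apply strict_inc_F|].
      change (supported G a b (iter_conj F n q)); rewrite Hq; apply Hw, Fs. }
    apply commutes_sym, (supported_commutes r G HG _ _ _ _ _ _ supported_U Qs).
    apply Rle_trans with (1 := ea), iter_F_inv.
Qed.

End Bump_arithmetic.

Theorem theoremC (r : R) (Lam A : R -> Prop) (G : (R -> R) -> Prop)
  (hr : 0 < r)
  (hLam : is_pos_mult_subgroup Lam) (hLam1 : exists l, Lam l /\ l <> 1)
  (hA : is_add_subgroup A) (hrA : A r)
  (hLA : forall l a, Lam l -> A a -> A (l * a))
  (HG : is_subgroup_V r G)
  (Hcap : forall f, (G f /\ inF r posR allR f) <-> inF r Lam A f) :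
  hereditarily_undecidable (Th (G_struct r G HG)).
Proof.
  destruct (small_slope Lam (/ 4) hLam hLam1) as [l [Ll hl]]; [lra|].
  (* Then [s] and [l * s] lie in [A] because [r] does. All supports are contained in
     [(0, 3 s + l s)], which [l < / 4] keeps below [r]. *)
  set (s := l * r).
  assert (hs : 0 < s < r / 4) by (unfold s; split; nra).
  assert (hls : 0 < l * s < s / 4) by (split; nra).
  assert (hlls : 0 < l * (l * s) < l * s) by (split; nra).
  assert (hsr : 3 * s + l * s < r) by lra.
  destruct hA as (A0 & Aadd & Aopp).
  assert (As : A s) by (apply hLA; auto).
  assert (Als : A (l * s)) by (apply hLA; auto).
  assert (El : / l * (l * s) = s) by (field; lra).
  assert (Bump : forall c s k, A c -> A s -> Lam k -> 0 < c -> 0 < s -> c + s + k * s < r ->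
    exists x : Gelt G, gfun G x = bump c s k /\ ginv G x = bump c (k * s) (/ k)).
  { intros; apply (bump_element r G Lam A); auto; [repeat split; auto|].
    intros f Hf; apply Hcap; exact Hf. }
  destruct (Bump (s + l * s) s l) as [F [HF HF']]; auto; [lra..|].
  destruct (Bump (s + l * s) (l * s) l) as [U [HU _]]; auto; [lra..|].
  (* The support [(s - l s, 2 s)] ends exactly where that of [W2] begins, so the two contracting
     pieces meet at the common fixed point [2 s]. *)
  destruct (Bump (s - l * s) (l * s) (/ l)) as [W1 [HW1 _]]; auto;
    [apply Aadd; auto|apply (proj2 (proj2 (proj2 hLam))); auto|lra..|].
  destruct (Bump (2 * s) s l) as [W2 [HW2 _]]; auto;
    [replace (2 * s) with (s + s) by lra; auto|lra..|].
  apply (hereditarily_undecidable_arith _ _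
    (group_arith _ (G_struct_group r G HG) _ _ _ _
      (bump_arithmetic_data r G HG s l (proj1 hs) hl ltac:(lra) F U W1 W2 HF HF' HU HW1 HW2))).
Qed.
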